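(* Let $q>2$ be a prime power, let $C$ be an $[n,k,d]_{q^2}$ linear code such that $C^{\perp h}\subseteq C$, and let $c\le n-k+1$ be a positive integer. Then there exists an $[[n+1,\,2k-n-1+c,\,d';\,c]]_q$ EAQECC with $d'\in\{d,d+1\}$.
   Context: An $[n,k,d]_{q^2}$ linear code is a $k$-dimensional subspace of $\mathbb{F}_{q^2}^n$ with minimum Hamming distance $d$. The Hermitian dual is $C^{\perp h}=\{v\in\mathbb{F}_{q^2}^n : \sum_i v_i w_i^q=0\ \forall w\in C\}$. An $[[n,k,d;c]]_q$ entanglement-assisted quantum error-correcting code (EAQECC) encodes $k$ logical qudits into $n$ physical qudits using $c$ copies of maximally entangled states pre-shared between sender and receiver. In standard terms: with $\mathcal{H}=\mathbb{C}^q$ and $\Phi=q^{-1/2}\sum_{i}|i\rangle|i\rangle\in\mathcal{H}\otimes\mathcal{H}$, it is a subspace $Q=\{(U\otimes I)(|\psi\rangle\otimes|0\rangle^{\otimes (n-k-c)}\otimes\Phi^{\otimes c}):\psi\in\mathcal{H}^{\otimes k}\}$ of $\mathcal{H}^{\otimes n}\otimes\mathcal{H}^{\otimes c}$, where $U$ is a unitary on the sender's $n$ qudits (the $k$ data qudits, the $n-k-c$ ancillas and the sender's halves of the $c$ pairs) and $I$ acts on the receiver's $c$ halves, such that, with $P$ the orthogonal projector onto $Q$, for every operator $E$ on $\mathcal{H}^{\otimes n}$ acting nontrivially on at most $d-1$ qudits there is a scalar $\lambda_E$ with $P(E\otimes I)P=\lambda_E P$. *)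

(* Defs.v *)
From HB Require Import structures.
From mathcomp Require Import all_boot all_order all_algebra all_field.
From mathcomp Require Import mxtens complex reals.

Set Implicit Arguments.
Unset Strict Implicit.
Unset Printing Implicit Defensive.

Import Order.TTheory GRing.Theory Num.Theory.

Local Open Scope ring_scope.
Local Open Scope sesquilinear_scope.

Section Codes.
Variables (F : finFieldType) (n : nat).

Definition hamming_dist (u v : 'rV[F]_n) : nat :=
  #|[set i : 'I_n | u 0 i != v 0 i]|.

(* The first clause forces C to contain two distinct words: the zero code has
   no minimum distance. *)
Definition min_dist (C : {vspace 'rV[F]_n}) (d : nat) : Prop :=
  (exists u v, [/\ u \in C, v \in C, u != v & hamming_dist u v = d]) /\
  (forall u v, u \in C -> v \in C -> u != v -> (d <= hamming_dist u v)%N).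

Definition linear_code (C : {vspace 'rV[F]_n}) (k d : nat) : Prop :=
  \dim C = k /\ min_dist C d.

(* Meant for #|F| = q ^ 2, where x |-> x ^+ q is the conjugation over the
   subfield of order q. *)
Definition hermitian_dual (q : nat) (C : {vspace 'rV[F]_n}) : {set 'rV[F]_n} :=
  [set v : 'rV[F]_n |
    [forall (w : 'rV[F]_n | w \in C), \sum_i v 0 i * w 0 i ^+ q == 0]].

End Codes.

(* Labels of the computational basis |x_1 ... x_n> of n qudits. *)
Definition word (q n : nat) := {ffun 'I_n -> 'I_q}.

(* The state space of n qudits is 'cV[Cx]_#|word q n|, the basis vector |x>
   sitting at index enum_rank x.  A bipartite space is 'cV[Cx]_(M * N), in
   which tensors are the Kronecker products *t of mxtens. *)
Section Quantum.
Variables (Cx : numClosedFieldType) (q : nat).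

Section LocalOperators.
Variable n : nat.

Definition restrict (S : {set 'I_n}) (x : word q n) :
    {ffun {i : 'I_n | i \in S} -> 'I_q} :=
  [ffun i => x (val i)].

(* E = F (x) I, with F acting on the qudits in S and I on the other ones. *)
Definition acts_on (S : {set 'I_n}) (E : 'M[Cx]_#|word q n|) : Prop :=
  exists F : {ffun {i : 'I_n | i \in S} -> 'I_q} ->
             {ffun {i : 'I_n | i \in S} -> 'I_q} -> Cx,
  forall x y : word q n,
    E (enum_rank x) (enum_rank y) =
      F (restrict S x) (restrict S y) *
      [forall (i | i \notin S), x i == y i]%:R.

Definition weight_le (E : 'M[Cx]_#|word q n|) (t : nat) : Prop :=
  exists S : {set 'I_n}, (#|S| <= t)%N /\ acts_on S E.

End LocalOperators.

Definition orthogonal_projector (N : nat) (P : 'M[Cx]_N)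
    (Q : {vspace 'cV[Cx]_N}) : Prop :=
  [/\ P *m P = P, P ^t* = P & forall v, v \in Q <-> P *m v = v].

Definition ket0 (a : 'I_q) : Cx := (a == 0%N :> nat)%:R.

Definition Phi (a b : 'I_q) : Cx := (sqrtC q%:R)^-1 * (a == b)%:R.

Section Code.
Variables k m c : nat.

(* The sender's qudits are k data qudits, then m ancillas, then the halves of
   the c shared pairs. *)
Definition data_pos (j : 'I_k) : 'I_(k + m + c) := lshift c (lshift m j).
Definition anc_pos (j : 'I_m) : 'I_(k + m + c) := lshift c (rshift k j).
Definition ent_pos (j : 'I_c) : 'I_(k + m + c) := rshift (k + m) j.

(* psi (x) |0>^m (x) Phi^c, its coordinate at |x>|y> with x on the sender's
   side and y on the receiver's side. *)
Definition input_state (psi : 'cV[Cx]_#|word q k|) :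
    'cV[Cx]_(#|word q (k + m + c)| * #|word q c|) :=
  \col_i
    let x : word q (k + m + c) := enum_val (mxtens_unindex i).1 in
    let y : word q c := enum_val (mxtens_unindex i).2 in
    psi (enum_rank [ffun j => x (data_pos j)]) 0 *
    (\prod_j ket0 (x (anc_pos j))) *
    (\prod_j Phi (x (ent_pos j)) (y j)).

Definition eaqecc (d : nat)
    (Q : {vspace 'cV[Cx]_(#|word q (k + m + c)| * #|word q c|)}) : Prop :=
  (exists2 U : 'M[Cx]_#|word q (k + m + c)|, U \is unitarymx &
     forall v, v \in Q <-> exists psi, v = (U *t 1%:M) *m input_state psi) /\
  (exists2 P, orthogonal_projector P Q &
     forall E : 'M[Cx]_#|word q (k + m + c)|, weight_le E (d - 1) ->
       exists lambda : Cx, P *m (E *t 1%:M) *m P = lambda *: P).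

End Code.

(* There is an [[n, k, d; c]]_q code; m is the number n - k - c of ancillas. *)
Definition eaqecc_exists (n k d c : nat) : Prop :=
  exists m : nat, n = (k + m + c)%N /\
  exists Q : {vspace 'cV[Cx]_(#|word q (k + m + c)| * #|word q c|)},
    eaqecc d Q.

End Quantum.

(* Main.v *)
Require Import Defs.
From HB Require Import structures.
From mathcomp Require Import all_boot all_order all_algebra all_field.
From mathcomp Require Import mxtens complex reals.
From mathcomp Require Import ring zify.

Set Implicit Arguments.
Unset Strict Implicit.
Unset Printing Implicit Defensive.

Import Order.TTheory GRing.Theory Num.Theory.

Local Open Scope ring_scope.

(* One may take d' = d. Let D be the Hermitian dual of C, extended by one free
   coordinate. Scaling the form at c - 1 coordinates of an information set of D
   by an element l of the field of order q other than 0 and 1 (this needs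
   q > 2) gives a form on D of rank c. The defect is compensated by letting the
   receiver hold a copy of these c coordinates, with the form scaled by 1 - l
   (by -1 for the free one), so that the corresponding Weyl operators commute
   and stabilize a code. A Weyl operator which fails to commute with a
   stabilizer element is detected. On the sender's side this covers all
   nontrivial errors of weight less than d, because the double dual of C is C.
   On the receiver's side it covers all nontrivial errors, because the c
   coordinates are independent; hence the receiver's share of the code is
   maximally entangled, which yields the encoding unitary. *)

(** * Orthogonal projectors, isometries and completion to unitaries *)

Section Projectors.
Local Open Scope sesquilinear_scope.
Variable Cx : numClosedFieldType.

Lemma adjmx_mul m n p (A : 'M[Cx]_(m, n)) (B : 'M[Cx]_(n, p)) :
  (A *m B) ^t* = B ^t* *m A ^t*.
Proof. by rewrite trmx_mul map_mxM. Qed.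

(** Gram-Schmidt on a basis of the row space of [P] gives the rows of [B]. The trace counts these
    rows, so [r] is forced. *)
Lemma projector_isometry N r (P : 'M[Cx]_N) :
  P *m P = P -> P ^t* = P -> \tr P = r%:R ->
  exists2 B : 'M[Cx]_(r, N), B *m B ^t* = 1%:M & B ^t* *m B = P.
Proof.
move=> PP Padj trP.
have [s [B BB eqBP]] :
    exists s, exists2 B : 'M[Cx]_(s, N), B *m B ^t* = 1%:M & (B :=: P)%MS.
  exists (\rank P), (schmidt (row_base P)).
    by apply/unitarymxP; rewrite schmidt_unitarymx ?rank_leq_col.
  apply: (eqmx_trans (eqmx_schmidt_free (row_base_free P))).
  exact: eq_row_base.
have BP : B *m P = B.
  have /submxP[D ->] : (B <= P)%MS by rewrite eqBP.
  by rewrite -mulmxA PP.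
have PBB : P *m B ^t* *m B = P.
  have /submxP[D PD] : (P <= B)%MS by rewrite eqBP.
  by rewrite PD -[D *m B *m _]mulmxA BB mulmx1.
have BBP : B ^t* *m B = P.
  by rewrite -[RHS]Padj -{}PBB 2!adjmx_mul trmxCK Padj BP.
have rE : r = s.
  by apply/eqP; rewrite -(eqr_nat Cx) -trP -BBP mxtrace_mulC BB mxtrace1.
by rewrite {}rE; exists B.
Qed.

(** In a full-rank factorization [P = A *m B], idempotence forces [B *m A = 1%:M], an identity
    matrix whose size is the rank. *)
Lemma tr_projector N (P : 'M[Cx]_N) : P *m P = P -> \tr P = (\rank P)%:R.
Proof.
move: (row_base_free P) (col_base_full P) (mulmx_base P).
move: (row_base P) (col_base P) => B A freeB fullA AB PP.
rewrite -[in LHS]AB mxtrace_mulC.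
suff -> : B *m A = 1%:M by rewrite mxtrace1.
apply: (row_free_inj freeB); apply: (row_full_inj fullA).
by rewrite /= mul1mx !mulmxA AB -mulmxA AB.
Qed.

(* [A] is completed by an isometry between the kernels of [A] and [A ^t*],
   which have the same dimension because [A ^t* *m A] and [A *m A ^t*] have
   the same trace. *)
Lemma partial_isometry_unitary N (A : 'M[Cx]_N) :
  A *m A ^t* *m A = A ->
  exists2 U, U \is unitarymx & U *m (A ^t* *m A) = A.
Proof.
move=> AAA; have AAA' : A ^t* *m A *m A ^t* = A ^t*.
  by rewrite -[RHS](congr1 (fun X => X ^t*) AAA) !adjmx_mul trmxCK mulmxA.
have proj (X : 'M[Cx]_N) : X *m X = X ->
    (1%:M - X) *m (1%:M - X) = 1%:M - X.
  by move=> XX; rewrite mulmxBr mulmx1 mulmxBl mul1mx XX subrr subr0.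
have adj (X : 'M[Cx]_N) : X ^t* = X -> (1%:M - X) ^t* = 1%:M - X.
  by move=> XX; rewrite linearB /= map_mxB XX trmx1 map_mx1.
set X := A ^t* *m A; set Y := A *m A ^t*.
have XX : X *m X = X by rewrite mulmxA AAA'.
have YY : Y *m Y = Y by rewrite mulmxA AAA.
have Xadj : X ^t* = X by rewrite adjmx_mul trmxCK.
have Yadj : Y ^t* = Y by rewrite adjmx_mul trmxCK.
have trX := tr_projector (proj X XX).
have trY : \tr (1%:M - Y) = (\rank (1%:M - X))%:R.
  by rewrite -trX !linearB /= [\tr Y]mxtrace_mulC.
have [B BB BX] := projector_isometry (proj X XX) (adj X Xadj) trX.
have [D DD DY] := projector_isometry (proj Y YY) (adj Y Yadj) trY.
have BA : B *m A ^t* = 0.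
  rewrite -[B]mul1mx -BB -2!mulmxA [_ *m (B *m _)]mulmxA BX mulmxBl mul1mx.
  by rewrite AAA' subrr mulmx0.
have AB : A *m B ^t* = 0.
  by rewrite -[LHS]trmxCK adjmx_mul trmxCK BA trmx0 map_mx0.
exists (A + D ^t* *m B).
  apply/unitarymxP; rewrite linearD /= map_mxD adjmx_mul trmxCK mulmxDl.
  rewrite !mulmxDr mulmxA AB mul0mx addr0 -[D ^t* *m B *m A ^t*]mulmxA BA.
  rewrite mulmx0 add0r -mulmxA [B *m _]mulmxA BB mul1mx DY.
  by rewrite -/Y addrC subrK.
by rewrite mulmxDl mulmxA AAA -mulmxA [B *m _]mulmxA BA mul0mx mulmx0 addr0.
Qed.

End Projectors.

(** * Projectors of commuting families of unitaries *)

Section Stabilizers.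
Local Open Scope sesquilinear_scope.
Variable Cx : numClosedFieldType.

(** [U] preserves the squared norm [x] of [v], which is nonzero. *)
Lemma unitary_eigenvalue N (U : 'M[Cx]_N) (v : 'rV[Cx]_N) a :
  U \is unitarymx -> v != 0 -> v *m U = a *: v -> a * a^* = 1.
Proof.
move=> /unitarymxP UU v0 vU; pose x := (v *m v ^t*) 0 0.
have x0 : x != 0.
  have [i vi0] : exists i, v 0 i != 0.
    apply/existsP; apply: contraNT v0 => /existsPn v0.
    by apply/eqP/rowP => i; rewrite mxE; apply/eqP; rewrite -[_ == _]negbK v0.
  apply: contraNneq vi0; rewrite /x mxE => /eqP.
  rewrite psumr_eq0 => [|j _]; last by rewrite !mxE mul_conjC_ge0.
  by move=> /allP/(_ i); rewrite mem_index_enum !mxE mul_conjC_eq0; apply.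
have : (v *m U) *m (v *m U) ^t* = v *m v ^t*.
  by rewrite adjmx_mul mulmxA -(mulmxA v) UU mulmx1.
rewrite vU linearZ /= map_mxZ -scalemxAl -scalemxAr scalerA.
move=> /matrixP/(_ 0 0); rewrite [LHS]mxE -/x => e.
by apply: (mulIf x0); rewrite mul1r.
Qed.

(* Commuting operators have a common eigenvector; dividing each [V s] by its
   eigenvalue turns the projective representation [V] into a genuine one,
   which is then averaged. *)
Lemma stabilizer_projector (S : finZmodType) N (V : S -> 'M[Cx]_N)
    (beta : S -> S -> Cx) :
  (0 < N)%N -> V 0 = 1%:M ->
  (forall s t, V s *m V t = beta s t *: V (s + t)) ->
  (forall s t, V s *m V t = V t *m V s) ->
  (forall s, V s \is unitarymx) ->
  (forall s, s != 0 -> \tr (V s) = 0) ->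
  exists (P : 'M[Cx]_N) (mu : S -> Cx),
  [/\ P *m P = P, P ^t* = P, \tr P * #|S|%:R = N%:R,
    forall s, mu s != 0 &
    forall s, V s *m P = mu s *: P /\ P *m V s = mu s *: P].
Proof.
move=> N_gt0 V0 VD Vcomm Vunitary Vtr.
have [|v v0 /allP vP] := @common_eigenvector Cx N [seq V s | s : S] N_gt0.
  by move=> _ _ /mapP[s _ ->] /mapP[t _ ->]; apply: Vcomm.
have /fin_all_exists[mu muP] : forall s, exists a, v *m V s = a *: v.
  move=> s; apply/sub_rVP; apply: vP; apply: map_f; exact: mem_enum.
have mu1 s : mu s * (mu s)^* = 1.
  exact: unitary_eigenvalue (Vunitary s) v0 (muP s).
have mu0 s : mu s != 0.
  apply/eqP => s0; have := mu1 s.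
  by rewrite s0 mul0r => /esym/eqP; rewrite oner_eq0.
have muV s : (mu s)^-1 = (mu s)^*.
  by apply: (mulfI (mu0 s)); rewrite mu1 divff.
have muD s t : mu s * mu t = beta s t * mu (s + t).
  have := muP (s + t) => /(congr1 (fun w => beta s t *: w)).
  rewrite scalemxAr -VD mulmxA muP -scalemxAl muP !scalerA => /eqP.
  by rewrite -subr_eq0 -scalerBl scaler_eq0 (negPf v0) orbF subr_eq0 => /eqP.
pose L s := (mu s)^-1 *: V s.
have LD s t : L s *m L t = L (s + t).
  rewrite /L -scalemxAl -scalemxAr VD !scalerA; congr (_ *: _).
  rewrite -invfM muD; have : beta s t * mu (s + t) != 0.
    by rewrite -muD mulf_neq0.
  by rewrite mulf_eq0 negb_or => /andP[b0 _]; rewrite invfM mulrAC mulVf ?mul1r.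
have L0 : L 0 = 1%:M.
  suff: mu 0 = 1 by rewrite /L V0 => ->; rewrite invr1 scale1r.
  have := muP 0; rewrite V0 mulmx1 => /esym/eqP; rewrite -subr_eq0.
  rewrite -{2}[v]scale1r -scalerBl scaler_eq0 (negPf v0) orbF subr_eq0.
  by move/eqP.
(* Each [L s] is unitary and [L] is multiplicative, so the adjoint of [L s] is its inverse
   [L (- s)]. Hence the average of the [L s] is self-adjoint. *)
have Ladj s : (L s) ^t* = L (- s).
  have LL : L s *m (L s) ^t* = 1%:M.
    rewrite /L linearZ /= map_mxZ -scalemxAl -scalemxAr scalerA.
    rewrite (unitarymxP (Vunitary s)) muV [X in _ * X]conjCK mulrC mu1.
    by rewrite scale1r.
  by rewrite -[LHS]mul1mx -L0 -(addNr s) -LD -mulmxA LL mulmx1.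
have S0 : #|S|%:R != 0 :> Cx.
  by rewrite pnatr_eq0 -lt0n; apply/card_gt0P; exists 0.
pose P := #|S|%:R^-1 *: \sum_s L s.
have LP s : L s *m P = P.
  rewrite /P -scalemxAr; congr (_ *: _); rewrite mulmx_sumr.
  rewrite [RHS](reindex (fun t => s + t)) /=; last first.
    by exists (fun t => - s + t) => t _; rewrite ?addKr ?addNKr.
  by apply: eq_bigr => t _; rewrite LD.
have LE s : V s = mu s *: L s by rewrite /L scalerA divff // scale1r.
have PP : P *m P = P.
  rewrite {1}/P -scalemxAl mulmx_suml.
  rewrite (eq_bigr (fun=> P)) => [|s _]; last exact: LP.
  by rewrite sumr_const -scaler_nat scalerA mulVf // scale1r.
have Padj : P ^t* = P.
  rewrite /P linearZ /= map_mxZ fmorphV rmorph_nat; congr (_ *: _).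
  rewrite [RHS](reindex_inj oppr_inj) [X in map_mx _ X]linear_sum /=.
  by rewrite map_mx_sum; apply: eq_bigr => s _; rewrite Ladj.
exists P, mu; split=> // [|s].
  (* Only the term at 0 has nonzero trace. *)
  rewrite /P linearZ /= mulrAC mulVf // mul1r raddf_sum (bigD1 0) //=.
  rewrite L0 mxtrace1 big1 ?addr0 // => s s0.
  by rewrite /L linearZ /= Vtr // mulr0.
split; first by rewrite LE -scalemxAl LP.
rewrite LE -scalemxAr -[P *m L s]trmxCK adjmx_mul Ladj Padj.
by rewrite LP Padj.
Qed.

(* [P V = mu P] on both sides of [E], which commutes with [V] up to [a]. *)
Lemma stabilizer_detect N (P V E : 'M[Cx]_N) (mu a : Cx) :
  mu != 0 -> V *m P = mu *: P -> P *m V = mu *: P ->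
  V *m E = a *: (E *m V) -> a != 1 -> P *m E *m P = 0.
Proof.
move=> mu0 VP PV VE a1.
have PVE : P *m V *m E *m P = mu *: (P *m E *m P) by rewrite PV -!scalemxAl.
have : P *m V *m E *m P = a *: (mu *: (P *m E *m P)).
  rewrite -(mulmxA P V) VE -scalemxAr -scalemxAl; congr (_ *: _).
  by rewrite !mulmxA -(mulmxA (P *m E)) VP -scalemxAr.
rewrite {}PVE.
move=> /eqP; rewrite scalerA -subr_eq0 -scalerBl scaler_eq0.
rewrite -[X in X - _]mul1r -mulrBl mulf_eq0 (negPf mu0) orbF subr_eq0 eq_sym.
by rewrite (negPf a1) => /eqP.
Qed.

End Stabilizers.

(** * From a projector to an entanglement-assisted code *)

Section EntanglementAssisted.
Local Open Scope sesquilinear_scope.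
Variable Cx : numClosedFieldType.

Lemma sum_mxtens_index m n (f : 'I_(m * n) -> Cx) :
  \sum_i f i = \sum_i \sum_j f (mxtens_index (i, j)).
Proof.
rewrite pair_bigA /= [LHS](reindex (@mxtens_index m n)) /=.
  by apply: eq_bigr => -[].
exists (@mxtens_unindex m n) => i _; first exact: mxtens_indexK.
exact: mxtens_unindexK.
Qed.

Lemma sum_enum_rank (T : finType) (f : 'I_#|T| -> Cx) :
  \sum_i f i = \sum_x f (enum_rank x).
Proof. by rewrite (reindex _ (onW_bij _ (enum_rank_bij T))). Qed.

Lemma mulmx_tens1 m n p (X : 'M[Cx]_m) (v : 'M[Cx]_(m * n, p)) i j l :
  ((X *t 1%:M) *m v) (mxtens_index (i, j)) l =
    \sum_h X i h * v (mxtens_index (h, j)) l.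
Proof.
rewrite mxE sum_mxtens_index; apply: eq_bigr => h _.
rewrite (bigD1 j) //= big1 ?addr0 => [|j' /negPf j'j]; rewrite tensmxE mxE.
  by rewrite eqxx mulr1.
by rewrite eq_sym j'j mulr0 mul0r.
Qed.

(** A matrix unit on the receiver's side selects two components of the columns of [V] and takes
    their inner product. This turns a condition on compressed receiver operators into orthogonality
    relations. *)
Lemma gram_tens_delta m n p (V : 'M[Cx]_(m * n, p)) j j' l l' :
  (V ^t* *m (1%:M *t delta_mx j j') *m V) l l' =
    \sum_i (V (mxtens_index (i, j)) l)^* * V (mxtens_index (i, j')) l'.
Proof.
have adjE i : (V ^t*) l i = (V i l)^* by rewrite !mxE.
rewrite -mulmxA mxE sum_mxtens_index; apply: eq_bigr => i _.
rewrite (bigD1 j) //= big1 ?addr0 => [|h /negPf hj]; rewrite adjE.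
  congr (_ * _); rewrite mxE sum_mxtens_index (bigD1 i) //= (bigD1 j') //=.
  rewrite !big1 ?addr0 => [|i' /negPf i'i|h /negPf hj].
  - by rewrite tensmxE !mxE !eqxx !mul1r.
  - by rewrite big1 // => h _; rewrite tensmxE !mxE eq_sym i'i !mul0r.
  by rewrite tensmxE !mxE hj andbF mulr0 mul0r.
rewrite mxE sum_mxtens_index big1 ?mulr0 // => i' _.
by rewrite big1 // => h' _; rewrite tensmxE !mxE hj mulr0 mul0r.
Qed.

Variables (q k m c : nat).
Hypothesis q_gt0 : (0 < q)%N.
Let word_data (w : word q (k + m + c)) : word q k :=
  [ffun j => w (data_pos m c j)].
Let word_ent (w : word q (k + m + c)) : word q c :=
  [ffun j => w (ent_pos k m j)].
Let anc0 (w : word q (k + m + c)) :=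
  [forall j, w (anc_pos k c j) == 0%N :> nat].
Let glue (z : word q k) (y : word q c) : word q (k + m + c) :=
  [ffun i => match split i with
             | inl i' => if split i' is inl j then z j else Ordinal q_gt0
             | inr j => y j end].

Let glue_data z y : word_data (glue z y) = z.
Proof.
apply/ffunP => j; rewrite !ffunE /data_pos.
by rewrite (unsplitK (inl _)) (unsplitK (inl _)).
Qed.

Let glue_ent z y : word_ent (glue z y) = y.
Proof. by apply/ffunP => j; rewrite !ffunE /ent_pos (unsplitK (inr _)). Qed.

Let glue_anc0 z y : anc0 (glue z y).
Proof.
apply/forallP => j; rewrite !ffunE /anc_pos.
by rewrite (unsplitK (inl _)) (unsplitK (inr _)).
Qed.

Let glueK w : anc0 w -> glue (word_data w) (word_ent w) = w.
Proof.
move=> /forallP w0; apply/ffunP => i; rewrite ffunE.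
case: split_ordP => [i' ->|j ->]; last by rewrite ffunE.
case: split_ordP => [j ->|j ->]; first by rewrite ffunE.
by apply/val_inj; rewrite /= (eqP (w0 j)).
Qed.

Let input_stateE psi w y :
  input_state m c psi (mxtens_index (enum_rank w, enum_rank y)) 0 =
  psi (enum_rank (word_data w)) 0 * (anc0 w)%:R *
    ((sqrtC q%:R ^+ c)^-1 * (word_ent w == y)%:R) :> Cx.
Proof.
rewrite mxE mxtens_indexK /= !enum_rankK; congr (_ * _ * _).
  rewrite /ket0; case: (boolP (anc0 w)) => [/forallP w0|].
    by rewrite big1 // => j _; rewrite w0.
  by case/forallPn => j /negPf wj; rewrite (bigD1 j) //= wj mul0r.
rewrite /Phi big_split /= prodr_const card_ord exprVn; congr (_ * _).
case: (eqVneq (word_ent w) y) => [<-|neq].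
  by rewrite big1 // => j _; rewrite ffunE eqxx.
have [j /negPf wj] : exists j, word_ent w j != y j.
  apply/existsP; apply: contraNT neq => /existsPn eqwy.
  by apply/eqP/ffunP => j; apply/eqP; rewrite -[_ == _]negbK eqwy.
by rewrite ffunE in wj; rewrite (bigD1 j) //= wj mul0r.
Qed.

Variables (d : nat) (P : 'M[Cx]_(#|word q (k + m + c)| * #|word q c|)).
Hypotheses (PP : P *m P = P) (Padj : P ^t* = P) (trP : \tr P = (q ^ k)%:R).
Hypothesis receiver : forall y y' : word q c,
  P *m (1%:M *t delta_mx (enum_rank y) (enum_rank y')) *m P =
    ((y == y')%:R / (q ^ c)%:R) *: P.

(* [B ^t*] is an isometry onto the code; by [receiver] its components along
   the receiver's basis states are, up to the factor [sqrt (q ^ c)],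
   orthonormal vectors of the sender's space, which are the values of the
   encoding unitary on the states with zero ancillas. *)
Lemma projector_encoding :
  exists2 U : 'M[Cx]_#|word q (k + m + c)|, U \is unitarymx &
    forall v, P *m v = v <-> exists psi, v = (U *t 1%:M) *m input_state m c psi.
Proof.
have [|B BB BP] := @projector_isometry Cx _ #|word q k| P PP Padj.
  by rewrite trP card_ffun !card_ord.
pose s : Cx := sqrtC q%:R ^+ c.
have s0 : s != 0 by rewrite expf_neq0 // sqrtC_eq0 pnatr_eq0 -lt0n.
have sE : s * s = (q ^ c)%:R by rewrite -exprMn -expr2 sqrtCK natrX.
have sadj : s^* = s.
  by rewrite /s rmorphXn /= geC0_conj // sqrtC_ge0 ler0n.
(* At a word with zero ancillas, the column is a receiver component of a column of [B ^t*],
   normalized by [s]; at any other word it is zero. So [A] is a partial isometry whose support is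
   the range of [D], the zero-ancilla states. *)
pose A : 'M[Cx]_#|word q (k + m + c)| := \matrix_(i, j)
  let w := enum_val j in
  (anc0 w)%:R * s * B ^t* (mxtens_index (i, enum_rank (word_ent w)))
                      (enum_rank (word_data w)).
pose D : 'M[Cx]_#|word q (k + m + c)| := \matrix_(i, j)
  ((i == j) && anc0 (enum_val j))%:R.
have BPid : B *m P = B by rewrite -BP mulmxA BB mul1mx.
have PBid : P *m B ^t* = B ^t* by rewrite -BP -mulmxA BB mulmx1.
have gram y y' : B *m (1%:M *t delta_mx (enum_rank y) (enum_rank y')) *m B ^t* =
    ((y == y')%:R / (q ^ c)%:R) *: 1%:M.
  set T := (_ *t _); transitivity (B *m (P *m T *m P) *m B ^t*).
    by rewrite !mulmxA BPid -!mulmxA PBid.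
  by rewrite receiver -scalemxAr -scalemxAl BPid BB.
have AA : A ^t* *m A = D.
  apply/matrixP => i j; rewrite [LHS]mxE [RHS]mxE.
  set w := enum_val i; set w' := enum_val j.
  pose t := (anc0 w)%:R * (anc0 w')%:R * (s * s).
  rewrite (eq_bigr (fun h => t *
    ((B ^t* (mxtens_index (h, enum_rank (word_ent w)))
            (enum_rank (word_data w)))^* *
     B ^t* (mxtens_index (h, enum_rank (word_ent w')))
           (enum_rank (word_data w'))))); last first.
    move=> h _; have adjE : (A ^t*) i h = (A h i)^* by rewrite !mxE.
    rewrite adjE ![A _ _]mxE -/w -/w' 2!rmorphM /= conjC_nat sadj /t.
    by rewrite mulrACA [_ * s * (_ * s)]mulrACA.
  rewrite -mulr_sumr -gram_tens_delta trmxCK gram !mxE /t sE.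
  have Q0 : (q ^ c)%:R != 0 :> Cx by rewrite -sE mulf_neq0.
  rewrite -!mulrA (mulrCA (q ^ c)%:R) (mulVKf Q0).
  rewrite -!natrM !mulnb (inj_eq enum_rank_inj); congr (nat_of_bool _)%:R.
  apply/idP/andP => [|[/eqP ij w0]].
    case/and4P => w0 w'0 /eqP e /eqP e'; split=> //; apply/eqP/enum_val_inj.
    by rewrite -/w -/w' -(glueK w0) -(glueK w'0) e e'.
  by rewrite /w ij -/w' w0 !eqxx.
have AAA : A *m A ^t* *m A = A.
  rewrite -mulmxA AA; apply/matrixP => i j; rewrite mxE (bigD1 j) //=.
  rewrite big1 ?addr0 => [|l /negPf lj]; rewrite [D _ _]mxE ?lj ?mulr0 //.
  by rewrite eqxx mxE /=; case: (anc0 _); rewrite ?mulr1 // !mul0r.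
have [U Uunitary UA] := partial_isometry_unitary AAA.
exists U => //.
have DI psi : (D *t 1%:M) *m input_state m c psi = input_state m c psi.
  apply/matrixP => i l; rewrite ord1; case: (mxtens_indexP i) => {}i j.
  rewrite mulmx_tens1 (bigD1 i) //= big1 ?addr0 => [|h /negPf hi].
    rewrite mxE eqxx /= -(enum_valK i) -(enum_valK j) input_stateE enum_rankK.
    by case: (anc0 _); rewrite ?mul1r // mulr0 !mul0r.
  by rewrite mxE eq_sym hi mul0r.
have UI psi : (U *t 1%:M) *m input_state m c psi = B ^t* *m psi.
  rewrite -DI mulmxA tensmx_mul mul1mx -AA UA.
  apply/matrixP => i l; rewrite ord1; case: (mxtens_indexP i) => {}i j.
  rewrite mulmx_tens1 mxE 2!sum_enum_rank.
  rewrite -(enum_valK j); set y := enum_val j.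
  (* The input state is nonzero only where the ancillas vanish and the sender's halves agree with
     [y]; such words are exactly the [glue z y]. *)
  rewrite (bigID (fun w => anc0 w && (word_ent w == y))) /= addrC big1 ?add0r.
    rewrite [LHS](reindex_onto (fun z => glue z y) word_data) /=.
      apply: eq_big => [z|z _].
        by rewrite glue_anc0 glue_ent glue_data !eqxx.
      rewrite input_stateE mxE enum_rankK /= glue_anc0 glue_ent glue_data eqxx.
      rewrite (_ : true%:R = 1) // !mulr1. rewrite mul1r -/s.
      by rewrite [s * _]mulrC -mulrA (mulrCA s) mulfV ?mulr1.
    by move=> w /andP[w0 /eqP <-]; rewrite glueK.
  move=> w; rewrite negb_and input_stateE => /orP[/negPf->|/negPf->].
    by rewrite mulr0 mul0r mulr0.
  by rewrite !mulr0.
move=> v; split=> [Pv|[psi ->]].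
  by exists (B *m v); rewrite UI mulmxA BP Pv.
by rewrite UI -BP -mulmxA (mulmxA B) BB mul1mx.
Qed.
Lemma projector_eaqecc :
  (forall E : 'M[Cx]_#|word q (k + m + c)|, weight_le E (d - 1) ->
     exists lambda : Cx, P *m (E *t 1%:M) *m P = lambda *: P) ->
  exists Q : {vspace 'cV[Cx]_(#|word q (k + m + c)| * #|word q c|)}, eaqecc d Q.
Proof.
move=> sender; have [U Uunitary UP] := projector_encoding.
pose Q := limg (linfun (mulmx P : 'cV[Cx]_(_ * _) -> _)).
have QP v : v \in Q <-> P *m v = v.
  split=> [/memv_imgP[u _ ->]|Pv]; first by rewrite lfunE /= mulmxA PP.
  by rewrite -Pv; apply/memv_imgP; exists v; rewrite ?memvf // lfunE.
exists Q; split; first by exists U => // v; rewrite QP.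
by exists P.
Qed.

End EntanglementAssisted.

(** * A nontrivial additive character of a finite field *)

Section AdditiveCharacter.
Variable Cx : numClosedFieldType.

(** Any root of [1 + X + ... + X^(p-1)] works; 1 is not a root because [p] is nonzero in [Cx]. *)
Lemma nontrivial_unity_root p : prime p ->
  exists2 z : Cx, z ^+ p = 1 & z != 1.
Proof.
move=> p_prime; have [p_gt0 p_gt1] := (prime_gt0 p_prime, prime_gt1 p_prime).
have [|z] := closed_rootP (\poly_(i < p) (1 : Cx)) _.
  by rewrite size_poly_eq ?oner_eq0 // neq_ltn p_gt1 orbT.
rewrite /root horner_poly (eq_bigr _ (fun _ _ => mul1r _)) => /eqP z0.
exists z; first by apply/eqP; rewrite -subr_eq0 subrX1 z0 mulr0.
apply/eqP => z1; move: z0; rewrite z1 (eq_bigr (fun=> 1)) => [|i _].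
  by rewrite sumr_const card_ord => /eqP; rewrite pnatr_eq0 -leqn0 leqNgt p_gt0.
by rewrite expr1n.
Qed.

(** A nontrivial [p]-th root of unity is raised to a coordinate over the prime field, chosen among
    those which do not vanish at [one]. *)
Lemma additive_character (F : finFieldType) :
  exists psi : F -> Cx, [/\ forall x y, psi (x + y) = psi x * psi y,
    forall x, psi x * (psi x)^* = 1 & exists x, psi x != 1].
Proof.
have [p p_prime pF] := finPcharP F; have p_gt1 := prime_gt1 p_prime.
have [z zp z1] := nontrivial_unity_root p_prime.
pose R : vectType 'F_p := pPrimeCharType pF; pose B := vbasis {:R}.
pose psi i (x : R) : Cx := z ^+ (coord B i x).
have psiD i x y : psi i (x + y) = psi i x * psi i y.
  by rewrite /psi linearD /= -exprD [X in (_ %% X)%N]Fp_cast // expr_mod.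
have znorm : z * z^* = 1.
  rewrite -normCK; have /eqP : `|z| ^+ p = 1 by rewrite -normrX zp normr1.
  by rewrite pexpr_eq1 ?prime_gt0 // => /eqP ->; rewrite expr1n.
pose one : R := (1 : F).
have [i onei] : exists i, coord B i one != 0.
  apply/existsP; apply: contraT => /existsPn one0.
  have : one != 0 by exact: oner_neq0 F.
  rewrite (coord_vbasis (memvf one)) big1 ?eqxx // => i _.
  by have := one0 i; rewrite negbK => /eqP ->; rewrite scale0r.
exists (psi i); split=> [||].
- exact: psiD.
- by move=> x; rewrite /psi rmorphXn /= -exprMn znorm expr1n.
exists ((coord B i one)^-1 *: one).
have -> : psi i ((coord B i one)^-1 *: one) = z ^+ (1%R : 'F_p).
  by rewrite /psi linearZ; congr (z ^+ nat_of_ord _); apply: mulVf.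
by rewrite /= [X in (_ %% X)%N]Fp_cast // modn_small.
Qed.

End AdditiveCharacter.

(** * The subfield of order [q] in the field of order [q ^ 2] *)

Section Subfield.
Variables (F : finFieldType) (p r q : nat).
Hypotheses (p_prime : prime p) (r_gt0 : (0 < r)%N) (q_def : q = (p ^ r)%N).
Hypothesis F_card : #|F| = (q ^ 2)%N.

Lemma subfield_pchar : [pchar F].-nat q.
Proof.
have pF : p \in [pchar F].
  by apply: (@card_finPcharP F p (r * 2)%N) => //; rewrite F_card q_def expnM.
by rewrite q_def pnatX (pnatE _ p_prime) pF.
Qed.

Lemma subfield_expD (x y : F) : (x + y) ^+ q = x ^+ q + y ^+ q.
Proof. exact: exprDn_pchar subfield_pchar. Qed.

Lemma subfield_expK (x : F) : x ^+ q ^+ q = x.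
Proof. by rewrite -exprM mulnn -F_card expf_card. Qed.

Lemma subfield_gt1 : (1 < q)%N.
Proof. by rewrite q_def -(exp1n r) ltn_exp2r ?prime_gt1. Qed.

(** The subfield is the root set of [X^q - X]. This polynomial divides [X^(q^2) - X], whose roots
    are all elements of [F], each simple, so it has exactly [q] distinct roots. *)
Lemma subfield_enum : exists e : 'I_q -> F,
  [/\ injective e, forall i, e i ^+ q = e i &
      forall x, x ^+ q = x -> exists i, e i = x].
Proof.
have q_gt1 := subfield_gt1.
pose P : {poly F} := 'X^q - 'X.
have sizeP : size P = q.+1.
  by rewrite size_polyDl size_polyXn // size_polyN size_polyX ltnS.
have [m Pm] : {m | P %= \prod_(x <- mask m (index_enum F)) ('X - x%:P)}.
  apply: dvdp_prod_XsubC; rewrite -finField_genPoly F_card.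
  (* Additivity of the [q]-th power gives [P ^+ q = X^(q^2) - X^q]; adding [P] cancels the middle
     term. *)
  have -> : 'X^(q ^ 2) - 'X = P ^+ q + P :> {poly F}.
    have polyq : [pchar {poly F}].-nat q.
      by rewrite (eq_pnat _ (@pchar_poly F)) subfield_pchar.
    have -> : P ^+ q = 'X^q ^+ q - 'X^q.
      rewrite /P exprDn_pchar //; congr (_ + _); apply/eqP.
      by rewrite -addr_eq0 -exprDn_pchar // addNr expr0n gtn_eqF // ltnW.
    by rewrite -exprM mulnn addrA subrK.
  by rewrite dvdp_add ?dvdpp ?dvdp_exp ?dvdpp // ltnW.
set s := mask m _ in Pm.
have s_uniq : uniq s by rewrite mask_uniq // index_enum_uniq.
have sP x : (x \in s) = (x ^+ q == x).
  rewrite -root_prod_XsubC -(eqp_root Pm) /root !hornerE.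
  by rewrite subr_eq0.
have s_size : size s = q.
  by apply/eqP; rewrite -eqSS -sizeP (eqp_size Pm) size_prod_XsubC.
exists (fun i : 'I_q => s`_i); split=> [i j /eqP|i|x xq].
- by rewrite nth_uniq ?s_size // => /eqP/val_inj.
- by apply/eqP; rewrite -sP mem_nth ?s_size.
have xs : x \in s by rewrite sP xq.
have ltxs : (index x s < q)%N by rewrite -s_size index_mem.
by exists (Ordinal ltxs); rewrite /= nth_index.
Qed.

Lemma subfield_proper : exists t : F, t ^+ q != t.
Proof.
apply/existsP; apply: contraT => /existsPn fixq.
have [e [_ _ e_surj]] := subfield_enum.
have allq (x : F) : x ^+ q = x by have := fixq x; rewrite negbK => /eqP.
have /fin_all_exists[g gK] : forall x, exists i, e i = x.
  by move=> x; apply: e_surj.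
have := leq_card g (can_inj gK); rewrite card_ord F_card -mulnn.
by rewrite leqNgt ltn_Pmull ?subfield_gt1 // ltnW ?subfield_gt1.
Qed.

End Subfield.

(** * Weyl operators on one qudit *)

Section Weyl.
Local Open Scope sesquilinear_scope.
Variables (Cx : numClosedFieldType) (F : finFieldType) (q : nat).

(* Operators on one qudit, labelled by the field of order [q ^ 2], which
   commute up to the values of [psi] on the form [lam * x * y ^+ q]. *)
Record weyl_system (psi : F -> Cx) (lam : F) (W : F -> 'M[Cx]_q) : Prop :=
  WeylSystem {
    weyl0 : W 0 = 1%:M;
    weylD : forall x y, exists b, W x *m W y = b *: W (x + y);
    weyl_unitary : forall x, W x \is unitarymx;
    weyl_tr : forall x, x != 0 -> \tr (W x) = 0;
    weylC : forall x y, W x *m W y = psi (lam * x * y ^+ q) *: (W y *m W x)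
  }.

Hypothesis q_gt0 : (0 < q)%N.
Hypothesis F_expD : forall x y : F, (x + y) ^+ q = x ^+ q + y ^+ q.
Hypothesis F_expK : forall x : F, x ^+ q ^+ q = x.

Let F_expN (x : F) : (- x) ^+ q = - x ^+ q.
Proof.
apply/eqP; rewrite -addr_eq0 addrC -F_expD subrr.
by rewrite expr0n gtn_eqF.
Qed.

(** The equation for [x] and its conjugate [x ^+ q = re x + im x * t ^+ q] determine both parts;
    subtracting them gives the formula for [im]. *)
Lemma real_imaginary_parts (t : F) : t ^+ q != t ->
  exists re im : F -> F,
  [/\ forall x, re x ^+ q = re x, forall x, im x ^+ q = im x,
      {morph re : x y / x + y}, {morph im : x y / x + y} &
      forall x, x = re x + im x * t].
Proof.
move=> t_proper; have tt0 : t - t ^+ q != 0 by rewrite subr_eq0 eq_sym.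
pose im (x : F) := (x - x ^+ q) / (t - t ^+ q).
have imK x : im x * (t - t ^+ q) = x - x ^+ q by rewrite divfK.
have im_fix x : im x ^+ q = im x.
  rewrite exprMn exprVn !F_expD !F_expN !F_expK.
  by rewrite -opprB -(opprB t) invrN mulrNN.
have imD : {morph im : x y / x + y}.
  by move=> x y; rewrite /im F_expD -mulrDl opprD addrACA.
exists (fun x => x - im x * t), im; split=> // [x|x y|x].
- rewrite F_expD F_expN exprMn im_fix.
  apply/eqP; rewrite -subr_eq0.
  have -> : x ^+ q - im x * t ^+ q - (x - im x * t) =
    im x * (t - t ^+ q) - (x - x ^+ q) by ring.
  by rewrite imK subrr.
- by rewrite imD mulrDl opprD addrACA.
by rewrite subrK.
Qed.

Section Construction.
Variables (e : 'I_q -> F) (t : F) (re im : F -> F) (psi : F -> Cx).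
Hypotheses (e_inj : injective e) (e_fix : forall i, e i ^+ q = e i).
Hypothesis e_surj : forall x, x ^+ q = x -> exists i, e i = x.
Hypotheses (re_fix : forall x, re x ^+ q = re x).
Hypotheses (im_fix : forall x, im x ^+ q = im x).
Hypotheses (reD : {morph re : x y / x + y}) (imD : {morph im : x y / x + y}).
Hypothesis reim : forall x, x = re x + im x * t.
Hypothesis psiD : forall x y, psi (x + y) = psi x * psi y.
Hypothesis psi_norm : forall x, psi x * (psi x)^* = 1.
Hypothesis psi_fix : forall x, x ^+ q = x -> psi x = 1.
Hypothesis psi_nontrivial : exists x, psi x != 1.

Let fixD (x y : F) : x ^+ q = x -> y ^+ q = y -> (x + y) ^+ q = x + y.
Proof. by move=> xq yq; rewrite F_expD xq yq. Qed.

Let fixN (x : F) : x ^+ q = x -> (- x) ^+ q = - x.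
Proof. by move=> xq; rewrite F_expN xq. Qed.

Let fixM (x y : F) : x ^+ q = x -> y ^+ q = y -> (x * y) ^+ q = x * y.
Proof. by move=> xq yq; rewrite exprMn xq yq. Qed.

Let im0 : im 0 = 0.
Proof. by apply: (addrI (im 0)); rewrite -imD !addr0. Qed.

Let re0 : re 0 = 0.
Proof. by apply: (addrI (re 0)); rewrite -reD !addr0. Qed.

Let psi0 : psi 0 = 1.
Proof. by rewrite psi_fix // expr0n gtn_eqF. Qed.

Variable lam : F.
Hypotheses (lam_fix : lam ^+ q = lam) (lam0 : lam != 0).

(** With basis states labelled by the subfield through [e], this is the generalized Pauli operator:
    a phase given by a character of the subfield, followed by the shift by [re x]. *)
Definition weyl_op (x : F) : 'M[Cx]_q := \matrix_(j, i)
  ((e j == e i + re x)%:R * psi (lam * im x * e i * t)).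

Let shift i x : exists j, e j = e i + re x.
Proof. by apply: e_surj; rewrite fixD. Qed.

Let weyl_opM x y :
  weyl_op x *m weyl_op y = psi (lam * im x * re y * t) *: weyl_op (x + y).
Proof.
apply/matrixP => j i; rewrite !mxE; have [l el] := shift i y.
rewrite (bigD1 l) //= big1 ?addr0 => [|l' l'l]; rewrite !mxE.
  rewrite el eqxx mul1r reD (addrC (re x)) (addrA (e i)) -mulrA -psiD.
  rewrite [RHS]mulrCA -psiD imD; congr (_ * psi _); ring.
by rewrite -el (inj_eq e_inj) (negPf l'l) mul0r mulr0.
Qed.

Let weyl_op_unitary x : weyl_op x \is unitarymx.
Proof.
apply/unitarymxP/matrixP => j j'; rewrite !mxE.
have [l el] : exists l, e l = e j - re x.
  by apply: e_surj; rewrite fixD // fixN.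
rewrite (bigD1 l) //= big1 ?addr0 => [|l' l'l]; rewrite !mxE.
  rewrite el subrK eqxx mul1r rmorphM /= conjC_nat (inj_eq e_inj).
  by rewrite mulrCA psi_norm mulr1 eq_sym.
rewrite (_ : e j == _ = false) ?mul0r //; apply: contraNF l'l => /eqP ej.
by rewrite -(inj_eq e_inj) el ej addrK.
Qed.

(** Translation by [c] permutes the subfield, which [e] enumerates. *)
Let sum_shift (f : F -> Cx) c : c ^+ q = c ->
  \sum_i f (e i + c) = \sum_i f (e i).
Proof.
move=> cq; have sumE (g : F -> Cx) :
    \sum_i g (e i) = \sum_(x | x ^+ q == x) g x.
  have /fin_all_exists[g' g'K] : forall x, exists i, x ^+ q == x -> e i = x.
    move=> x; have [/eqP/e_surj[i <-]|_] := boolP (x ^+ q == x).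
      by exists i.
    by exists (Ordinal q_gt0).
  rewrite [RHS](reindex_onto e g') => [|x /g'K//].
  apply: eq_bigl => i; rewrite e_fix eqxx /=.
  by apply/esym/eqP/e_inj; rewrite g'K // e_fix.
rewrite (sumE (fun x => f (x + c))) (sumE f).
rewrite [RHS](reindex_inj (addIr c)) /=; apply: eq_bigl => x.
by rewrite F_expD cq (inj_eq (addIr c)).
Qed.

(** If [re x] is nonzero, the shift leaves no diagonal entry. Otherwise the trace is the sum of a
    nontrivial character over the subfield. *)
Let weyl_op_tr x : x != 0 -> \tr (weyl_op x) = 0.
Proof.
move=> x0; rewrite /mxtrace; have [re_x|re_x] := eqVneq (re x) 0; last first.
  rewrite big1 // => i _; rewrite mxE -{1}[e i]addr0 (inj_eq (addrI _)).
  by rewrite eq_sym (negPf re_x) mul0r.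
have im_x : im x != 0.
  by apply: contraNneq x0 => im_x; rewrite [x]reim re_x im_x mul0r addr0.
have [z] := psi_nontrivial.
rewrite [z]reim psiD (psi_fix (re_fix z)) mul1r => z1.
pose f y := psi (lam * im x * y * t).
have -> : \sum_i weyl_op x i i = \sum_i f (e i).
  by apply: eq_bigr => i _; rewrite mxE re_x addr0 eqxx mul1r.
(* The shift by [c] multiplies each summand by [psi (im z * t)], which is not 1, and yet preserves
   the sum. *)
pose c := im z / (lam * im x).
have cq : c ^+ q = c by rewrite fixM // exprVn fixM.
have := sum_shift f cq.
rewrite (eq_bigr (fun i => f (e i) * psi (im z * t))) => [|i _]; last first.
  rewrite -psiD; congr (psi _); rewrite mulrDr mulrDl; congr (_ + _ * _).
  by rewrite mulrC divfK ?mulf_neq0.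
rewrite -mulr_suml => /eqP; rewrite -[X in _ == X]mulr1 -subr_eq0 -mulrBr.
by rewrite mulf_eq0 subr_eq0 (negPf z1) orbF => /eqP.
Qed.

(** Reordering the factors yields the exponent [lam * (im x * re y - im y * re x) * t]. It differs
    from [lam * x * y ^+ q] by an element [c] of the subfield, made of the trace and norm of [t],
    and [psi] is trivial there. *)
Let weyl_opC x y :
  weyl_op x *m weyl_op y = psi (lam * x * y ^+ q) *: (weyl_op y *m weyl_op x).
Proof.
rewrite !weyl_opM [y + x]addrC scalerA -psiD; congr (_ *: _).
have yq : y ^+ q = re y + im y * t ^+ q.
  by rewrite {1}[y]reim F_expD re_fix exprMn im_fix.
pose c := lam * (re x * re y + im x * im y * (t * t ^+ q)
                 + re x * im y * (t + t ^+ q)).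
have cq : c ^+ q = c.
  have norm_fix : (t * t ^+ q) ^+ q = t * t ^+ q.
    by rewrite exprMn F_expK mulrC.
  have trace_fix : (t + t ^+ q) ^+ q = t + t ^+ q.
    by rewrite F_expD F_expK addrC.
  by do ![exact: norm_fix | exact: trace_fix | done | apply: fixD
         | apply: fixM].
rewrite -[LHS]mul1r -(psi_fix cq) -psiD; congr (psi _).
by rewrite yq {2}[x]reim /c; ring.
Qed.

Lemma weyl_op_system : weyl_system psi lam weyl_op.
Proof.
split=> //; last by move=> x y; eexists; apply: weyl_opM.
apply/matrixP => j i; rewrite !mxE re0 im0 addr0 (inj_eq e_inj).
by rewrite mulr0 !mul0r psi0 mulr1.
Qed.

End Construction.
End Weyl.

(** * Weyl operators as an orthogonal basis, and their existence *)

Section WeylExpansion.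
Local Open Scope sesquilinear_scope.
Variables (Cx : numClosedFieldType) (F : finFieldType) (q : nat).
Hypotheses (q_gt0 : (0 < q)%N) (F_card : #|F| = (q ^ 2)%N).

(** The adjoint of [W x] is a multiple of [W (- x)], so for distinct [x] and [y] the product is a
    multiple of the traceless [W (- x + y)]. *)
Lemma weyl_tr_adj psi lam (W : F -> 'M[Cx]_q) x y :
  weyl_system psi lam W -> \tr ((W x) ^t* *m W y) = (x == y)%:R * q%:R.
Proof.
move=> sysW; have WW z : (W z) ^t* *m W z = 1%:M.
  by apply/mulmx1C/unitarymxP/(weyl_unitary sysW).
case: eqVneq => [->|xy]; first by rewrite WW mxtrace1 mul1r.
have [b Wb] := weylD sysW (- x) x; have [b' Wb'] := weylD sysW (- x) y.
rewrite addNr (weyl0 sysW) in Wb.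
have /unitarymxP WWx := weyl_unitary sysW x.
have b0 : b != 0.
  apply/eqP => b0; have Wx0 : W (- x) = 0.
    by rewrite -[LHS]mulmx1 -WWx mulmxA Wb b0 scale0r mul0mx.
  have /unitarymxP := weyl_unitary sysW (- x); rewrite Wx0 mul0mx.
  move=> /matrixP/(_ (Ordinal q_gt0) (Ordinal q_gt0)).
  by rewrite !mxE eqxx => /esym/eqP; rewrite oner_eq0.
have -> : (W x) ^t* = b^-1 *: W (- x).
  rewrite -[W (- x)]mulmx1 -WWx mulmxA Wb -scalemxAl mul1mx scalerA.
  by rewrite mulVf ?scale1r.
rewrite -scalemxAl Wb' !linearZ /= (weyl_tr sysW) ?mulr0 ?mul0r //.
by rewrite addrC subr_eq0 eq_sym.
Qed.

(** The operators are orthogonal for the trace form, hence free, and their number [q ^ 2] is the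
    dimension of the matrix space. *)
Lemma weyl_expand psi lam (W : F -> 'M[Cx]_q) (M : 'M[Cx]_q) :
  weyl_system psi lam W ->
  M = \sum_x (q%:R^-1 * \tr ((W x) ^t* *m M)) *: W x.
Proof.
move=> sysW; pose X := [tuple W (enum_val i) | i < #|F|].
have q0 : q%:R != 0 :> Cx by rewrite pnatr_eq0 -lt0n.
have trX (k : F -> Cx) x : \tr ((W x) ^t* *m \sum_y k y *: W y) = k x * q%:R.
  rewrite mulmx_sumr linear_sum (bigD1 x) //= -scalemxAr linearZ /=.
  rewrite (weyl_tr_adj _ _ sysW) eqxx mul1r big1 ?addr0 // => y yx.
  rewrite -scalemxAr linearZ /= (weyl_tr_adj _ _ sysW) eq_sym (negPf yx).
  by rewrite mul0r mulr0.
have sumX (k : 'I_#|F| -> Cx) :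
    \sum_i k i *: X`_i = \sum_y k (enum_rank y) *: W y.
  rewrite (reindex _ (onW_bij _ (enum_rank_bij F))); apply: eq_bigr => y _.
  by rewrite -tnth_nth tnth_mktuple enum_rankK.
have freeX : free X.
  apply/freeP => k; rewrite sumX => k0 i.
  have := trX (fun y => k (enum_rank y)) (enum_val i).
  rewrite k0 mulmx0 linear0 enum_valK => /esym/eqP.
  by rewrite mulf_eq0 (negPf q0) orbF => /eqP.
have spanX : <<X>>%VS = fullv.
  apply/eqP; rewrite eqEdim subvf /= dimvf (eqnP freeX) size_tuple F_card.
  by rewrite /dim /= -mulnn.
have : M \in <<X>>%VS by rewrite spanX memvf.
move=> /coord_span; rewrite (sumX (fun i => coord X i M)) => ME.
rewrite [LHS]ME; apply: eq_bigr => x _; rewrite [in RHS]ME trX.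
by rewrite mulrC mulfK.
Qed.

End WeylExpansion.

Lemma weyl_systems_exist (Cx : numClosedFieldType) (F : finFieldType)
    (p r q : nat) :
  prime p -> (0 < r)%N -> q = (p ^ r)%N -> #|F| = (q ^ 2)%N ->
  exists (psi : F -> Cx) (W : F -> F -> 'M[Cx]_q),
  [/\ forall x y, psi (x + y) = psi x * psi y, psi 0 = 1,
      exists x, psi x != 1 &
      forall lam, lam ^+ q = lam -> lam != 0 -> weyl_system psi lam (W lam)].
Proof.
move=> p_prime r_gt0 q_def F_card.
have [psi0 [psi0D psi0_norm [z z1]]] := additive_character Cx F.
have [e [e_inj e_fix e_surj]] := subfield_enum p_prime r_gt0 q_def F_card.
have [t t_proper] := subfield_proper p_prime r_gt0 q_def F_card.
have q_gt0 := ltnW (subfield_gt1 p_prime r_gt0 q_def).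
have F_expD := subfield_expD p_prime q_def F_card.
have F_expK := subfield_expK F_card.
have [re [im [re_fix im_fix reD imD reim]]] :=
  real_imaginary_parts q_gt0 F_expD F_expK t_proper.
have tt0 : t - t ^+ q != 0 by rewrite subr_eq0 eq_sym.
(* The difference [x - x ^+ q] vanishes on the subfield, where [psi] has to be trivial; the factor
   in front makes [psi t] equal to [psi0 z], which is not 1. *)
pose psi x := psi0 (z / (t - t ^+ q) * (x - x ^+ q)).
have psiD x y : psi (x + y) = psi x * psi y.
  by rewrite /psi F_expD opprD addrACA mulrDr psi0D.
have psi_fix x : x ^+ q = x -> psi x = 1.
  move=> xq; rewrite /psi xq subrr mulr0.
  have psi00 : psi0 0 != 0.
    apply/eqP => psi00; have := psi0_norm 0.
    by rewrite psi00 mul0r => /esym/eqP; rewrite oner_eq0.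
  by apply: (mulfI psi00); rewrite -psi0D addr0 mulr1.
have psi_nontrivial : exists x, psi x != 1 by exists t; rewrite /psi divfK.
exists psi, (weyl_op e t re im psi); split=> // [|lam lam_fix lam0].
  by rewrite psi_fix // expr0n gtn_eqF.
by apply: weyl_op_system => // x; rewrite ?psi0_norm.
Qed.

(** * Tensor products of one-qudit operators *)

Section TensorPowers.
Local Open Scope sesquilinear_scope.
Variables (Cx : numClosedFieldType) (q n : nat).
Implicit Types M : 'I_n -> 'M[Cx]_q.

Definition ntens M : 'M[Cx]_#|word q n| :=
  \matrix_(u, v) \prod_i M i ((enum_val u : word q n) i)
                             ((enum_val v : word q n) i).

Lemma ntensE M (u v : word q n) :
  ntens M (enum_rank u) (enum_rank v) = \prod_i M i (u i) (v i).
Proof. by rewrite mxE !enum_rankK. Qed.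

Lemma matrix_enumP (A B : 'M[Cx]_#|word q n|) :
  (forall u v : word q n, A (enum_rank u) (enum_rank v) =
                          B (enum_rank u) (enum_rank v)) -> A = B.
Proof.
by move=> AB; apply/matrixP => u v; rewrite -(enum_valK u) -(enum_valK v).
Qed.

Lemma eq_ntens M M' : M =1 M' -> ntens M = ntens M'.
Proof.
move=> eqM; apply/matrixP => u v; rewrite !mxE.
by apply: eq_bigr => i _; rewrite eqM.
Qed.

Lemma ntensM M M' : ntens M *m ntens M' = ntens (fun i => M i *m M' i).
Proof.
apply: matrix_enumP => u v; rewrite mxE ntensE.
under [RHS]eq_bigr => i _ do rewrite mxE.
rewrite bigA_distr_bigA sum_enum_rank.
by apply: eq_bigr => w _; rewrite !ntensE big_split.
Qed.

Lemma ntens_scale (k : 'I_n -> Cx) M :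
  ntens (fun i => k i *: M i) = (\prod_i k i) *: ntens M.
Proof.
apply: matrix_enumP => u v; rewrite [RHS]mxE !ntensE -big_split.
by apply: eq_bigr => i _; rewrite mxE.
Qed.

Lemma ntens1 : ntens (fun=> 1%:M) = 1%:M.
Proof.
apply: matrix_enumP => u v; rewrite ntensE mxE (inj_eq enum_rank_inj).
case: eqVneq => [->|uv]; first by rewrite big1 // => i _; rewrite mxE eqxx.
have [i /negPf uvi] : exists i, u i != v i.
  apply/existsP; apply: contraNT uv => /existsPn uv.
  by apply/eqP/ffunP => i; have := uv i; rewrite negbK => /eqP.
by rewrite (bigD1 i) //= mxE uvi mul0r.
Qed.

Lemma ntens_adj M : (ntens M) ^t* = ntens (fun i => (M i) ^t*).
Proof.
apply: matrix_enumP => u v; rewrite 2!mxE !ntensE rmorph_prod.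
by apply: eq_bigr => i _; rewrite !mxE.
Qed.

Lemma ntens_unitary M :
  (forall i, M i \is unitarymx) -> ntens M \is unitarymx.
Proof.
move=> M_unitary; apply/unitarymxP; rewrite ntens_adj ntensM -ntens1.
by apply: eq_ntens => i; apply/unitarymxP.
Qed.

Lemma tr_ntens M : \tr (ntens M) = \prod_i \tr (M i).
Proof.
rewrite /mxtrace bigA_distr_bigA sum_enum_rank.
by apply: eq_bigr => u _; rewrite ntensE.
Qed.

Lemma ntens_sum (J : finType) (k : 'I_n -> J -> Cx)
    (W : 'I_n -> J -> 'M[Cx]_q) :
  ntens (fun i => \sum_j k i j *: W i j) =
    \sum_(f : {ffun 'I_n -> J})
      (\prod_i k i (f i)) *: ntens (fun i => W i (f i)).
Proof.
apply: matrix_enumP => u v; rewrite ntensE summxE.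
under eq_bigr => i _ do rewrite summxE.
rewrite bigA_distr_bigA.
apply: eq_bigr => f _; rewrite -ntens_scale ntensE.
by apply: eq_bigr.
Qed.

Lemma delta_ntens (u v : word q n) :
  delta_mx (enum_rank u) (enum_rank v) = ntens (fun i => delta_mx (u i) (v i)).
Proof.
apply: matrix_enumP => u' v'; rewrite ntensE mxE !(inj_eq enum_rank_inj).
case: eqVneq => [->|uu]; case: eqVneq => [->|vv] /=.
- by rewrite big1 // => i _; rewrite mxE !eqxx.
- have [i vi] : exists i, v' i != v i.
    apply/existsP; apply: contraNT vv => /existsPn vv.
    by apply/eqP/ffunP => i; have := vv i; rewrite negbK => /eqP.
  by rewrite (bigD1 i) //= mxE (negPf vi) andbF mul0r.
all: have [i ui] : exists i, u' i != u i.
1,3: apply/existsP; apply: contraNT uu => /existsPn uu;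
     by apply/eqP/ffunP => i; have := uu i; rewrite negbK => /eqP.
all: by rewrite (bigD1 i) //= mxE (negPf ui) mul0r.
Qed.

(** The local factor is expanded in matrix units on the qudits of [S], its entries being the
    coefficients. *)
Lemma acts_on_ntens (S : {set 'I_n}) (E : 'M[Cx]_#|word q n|) :
  acts_on S E ->
  exists (J : finType) (k : J -> Cx) (M : J -> 'I_n -> 'M[Cx]_q),
    E = \sum_j k j *: ntens (M j) /\ forall j i, i \notin S -> M j i = 1%:M.
Proof.
move=> [f Ef]; pose L := {ffun {i | i \in S} -> 'I_q}.
pose M (st : L * L) i := if insub i is Some j
  then delta_mx (st.1 j) (st.2 j) else 1%:M : 'M[Cx]_q.
exists (L * L)%type, (fun st => f st.1 st.2), M; split=> [|st i iS]; last first.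
  by rewrite /M insubN.
apply: matrix_enumP => u v; rewrite Ef summxE.
rewrite (bigD1 (Defs.restrict S u, Defs.restrict S v)) //=.
rewrite big1 ?addr0 => [|[s t] st].
  rewrite mxE ntensE; congr (_ * _); rewrite (bigID (mem S)) /=.
  rewrite big1 ?mul1r => [|i iS]; last first.
    by rewrite /M insubT mxE !ffunE /= !eqxx.
  rewrite (eq_bigr (fun i => (u i == v i)%:R)) => [|i iS]; last first.
    by rewrite /M insubN // mxE.
  have [/forall_inP uv|/forall_inPn[i iS /negPf uvi]] :=
      boolP [forall (i | i \notin S), u i == v i].
    by rewrite big1 // => i iS; rewrite uv.
  by rewrite (bigD1 i) //= uvi mul0r.
rewrite mxE ntensE.
suff [j stj] : exists j : {i | i \in S}, (u (val j), v (val j)) != (s j, t j).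
  rewrite (bigD1 (val j)) //= /M valK /= mxE.
  by move: stj; rewrite xpair_eqE => /negPf ->; rewrite mul0r mulr0.
apply/existsP; apply: contraNT st => /existsPn st.
rewrite xpair_eqE; apply/andP; split; apply/eqP/ffunP => j; rewrite !ffunE.
  by have := st j; rewrite negbK => /eqP[].
by have := st j; rewrite negbK => /eqP[].
Qed.

(** [L] stands for the compression by [P] of an operator on one of the two sides. After expansion of
    each [M i] in Weyl operators, only the identity term survives. *)
Lemma ntens_detect N (P : 'M[Cx]_N) (L : 'M[Cx]_#|word q n| -> 'M[Cx]_N)
    (F : finFieldType) (psi : F -> Cx) (lam : 'I_n -> F)
    (W : 'I_n -> F -> 'M[Cx]_q) (S : {set 'I_n}) (M : 'I_n -> 'M[Cx]_q) :
  (0 < q)%N -> #|F| = (q ^ 2)%N ->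
  (forall i, weyl_system psi (lam i) (W i)) ->
  (forall k A B, L (k *: A + B) = k *: L A + L B) -> L 1%:M = P ->
  (forall x : {ffun 'I_n -> F}, (exists i, x i != 0) ->
     (forall i, i \notin S -> x i = 0) ->
     L (ntens (fun i => W i (x i))) = 0) ->
  (forall i, i \notin S -> M i = 1%:M) ->
  L (ntens M) = (\prod_i (\tr (M i) / q%:R)) *: P.
Proof.
move=> q_gt0 F_card sysW L_lin L1 L0 MS.
have q0 : q%:R != 0 :> Cx by rewrite pnatr_eq0 -lt0n.
have L_0 : L 0 = 0.
  apply: (addrI (L 0)); rewrite -[X in X + _]scale1r -L_lin scale1r.
  by rewrite !addr0.
have L_sum (J : finType) (k : J -> Cx) A :
    L (\sum_j k j *: A j) = \sum_j k j *: L (A j).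
  by elim/big_rec2: _ => // j B B' _ <-; rewrite L_lin.
pose k i x : Cx := q%:R^-1 * \tr ((W i x) ^t* *m M i).
have -> : ntens M = ntens (fun i => \sum_x k i x *: W i x).
  by apply: eq_ntens => i; apply: weyl_expand (sysW i).
rewrite ntens_sum L_sum (bigD1 [ffun=> 0]) //=.
have -> : ntens (fun i => W i ([ffun=> 0] i)) = 1%:M.
  by rewrite -ntens1; apply: eq_ntens => i; rewrite ffunE (weyl0 (sysW i)).
rewrite L1 -[RHS]addr0; congr (_ *: _ + _).
  apply: eq_bigr => i _; rewrite ffunE /k (weyl0 (sysW i)).
  by rewrite trmx1 map_mx1 mul1mx mulrC.
apply: big1 => x x0.
(* A nonzero label supported in [S] is killed by [L]. Any other one has a zero coefficient, since
   [M i] is the identity outside [S] and nontrivial Weyl operators are traceless. *)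
have [xS|] := boolP [forall (i | i \notin S), x i == 0].
  rewrite L0 ?scaler0 //; last by move=> i iS; apply/eqP/(forall_inP xS).
  apply/existsP; apply: contraNT x0 => /existsPn x0.
  by apply/eqP/ffunP => i; have := x0 i; rewrite negbK ffunE => /eqP.
case/forall_inPn => i iS xi; rewrite (bigD1 i) //= /k MS // mulmx1.
have -> : \tr ((W i (x i)) ^t*) = (\tr (W i (x i)))^*.
  by rewrite /mxtrace rmorph_sum; apply: eq_bigr => l _; rewrite !mxE.
by rewrite (weyl_tr (sysW i)) // rmorph0 mulr0 mul0r scale0r.
Qed.

End TensorPowers.

(** * Entanglement-assisted codes from pairs of Weyl operators *)

Section StabilizerCode.
Local Open Scope sesquilinear_scope.
Variables (Cx : numClosedFieldType) (F : finFieldType) (q : nat).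

Lemma tensmx_scale m n m' n' (a b : Cx) (A : 'M_(m, n)) (B : 'M_(m', n')) :
  (a *: A) *t (b *: B) = (a * b) *: (A *t B).
Proof. by apply/matrixP => i j; rewrite !mxE mulrACA. Qed.

Lemma tensmx_lin m n m' n' (a : Cx) (A A' : 'M_(m, n)) (B : 'M_(m', n')) :
  (a *: A + A') *t B = a *: (A *t B) + A' *t B.
Proof. by apply/matrixP => i j; rewrite !mxE mulrDl mulrA. Qed.

Lemma tensmx_linr m n m' n' (a : Cx) (A : 'M_(m, n)) (B B' : 'M_(m', n')) :
  A *t (a *: B + B') = a *: (A *t B) + A *t B'.
Proof. by apply/matrixP => i j; rewrite !mxE mulrDr mulrCA. Qed.

Lemma tensmx11 m n : 1%:M *t 1%:M = 1%:M :> 'M[Cx]_(m * n).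
Proof.
apply/matrixP => a b; case: (mxtens_indexP a) => i j.
case: (mxtens_indexP b) => i' j'; rewrite tensmxE !mxE -natrM mulnb.
by rewrite (inj_eq (can_inj (@mxtens_indexK m n))) xpair_eqE.
Qed.

Lemma tensmx_unitary m n (A : 'M[Cx]_m) (B : 'M[Cx]_n) :
  A \is unitarymx -> B \is unitarymx -> A *t B \is unitarymx.
Proof.
move=> /unitarymxP AA /unitarymxP BB; apply/unitarymxP.
by rewrite trmx_tens map_mxT tensmx_mul AA BB tensmx11.
Qed.

Lemma mxtrace_tens m n (A : 'M[Cx]_m) (B : 'M[Cx]_n) :
  \tr (A *t B) = \tr A * \tr B.
Proof.
rewrite /mxtrace sum_mxtens_index big_distrl; apply: eq_bigr => i _.
by rewrite big_distrr; apply: eq_bigr => j _; rewrite tensmxE.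
Qed.

Variables (psi : F -> Cx) (W : F -> F -> 'M[Cx]_q).
Hypotheses (q_gt0 : (0 < q)%N) (F_card : #|F| = (q ^ 2)%N).
Hypothesis psiD : forall x y, psi (x + y) = psi x * psi y.
Hypothesis psi0 : psi 0 = 1.
Hypothesis sysW : forall lam, lam ^+ q = lam -> lam != 0 ->
  weyl_system psi lam (W lam).

Section Multi.
Variables (n : nat) (lam : 'I_n -> F).
Hypothesis lam_fix : forall i, lam i ^+ q = lam i.
Hypothesis lam0 : forall i, lam i != 0.

Let sys i : weyl_system psi (lam i) (W (lam i)).
Proof. exact: sysW. Qed.

Definition nweyl (x : 'I_n -> F) := ntens (fun i => W (lam i) (x i)).

Lemma nweyl0 x : (forall i, x i = 0) -> nweyl x = 1%:M.
Proof.
move=> x0; rewrite -ntens1; apply: eq_ntens => i.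
by rewrite x0 (weyl0 (sys i)).
Qed.

Lemma nweylD x y z : (forall i, z i = x i + y i) ->
  exists b, nweyl x *m nweyl y = b *: nweyl z.
Proof.
move=> zE; have /fin_all_exists[b bE] i := weylD (sys i) (x i) (y i).
exists (\prod_i b i); rewrite ntensM -ntens_scale.
by apply: eq_ntens => i; rewrite bE zE.
Qed.

Lemma nweylC x y : nweyl x *m nweyl y =
  psi (\sum_i lam i * x i * y i ^+ q) *: (nweyl y *m nweyl x).
Proof.
rewrite (big_morph psi psiD psi0) !ntensM -ntens_scale.
by apply: eq_ntens => i; apply: (weylC (sys i)).
Qed.

Lemma nweyl_unitary x : nweyl x \is unitarymx.
Proof. by apply: ntens_unitary => i; apply: (weyl_unitary (sys i)). Qed.

Lemma nweyl_tr x i : x i != 0 -> \tr (nweyl x) = 0.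
Proof.
by move=> xi; rewrite tr_ntens (bigD1 i) //= (weyl_tr (sys i)) // mul0r.
Qed.

End Multi.

(* The stabilizer consists of the operators [nweyl lam (g s)] on the sender's
   side times [nweyl mu (h s)] on the receiver's side; by [isotropic] they
   commute although the factors need not. *)
Lemma stabilizer_eaqecc (k m c d : nat) (lam : 'I_(k + m + c) -> F)
    (mu : 'I_c -> F) (S : finZmodType) (g : S -> 'I_(k + m + c) -> F)
    (h : S -> 'I_c -> F)
    (lam_fix : forall i, lam i ^+ q = lam i) (lam0 : forall i, lam i != 0)
    (mu_fix : forall j, mu j ^+ q = mu j) (mu0 : forall j, mu j != 0)
    (gD : forall s t i, g (s + t) i = g s i + g t i)
    (hD : forall s t j, h (s + t) j = h s j + h t j)
    (g_neq0 : forall s, s != 0 -> exists i, g s i != 0)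
    (isotropic : forall s t, \sum_i lam i * g s i * g t i ^+ q +
                             \sum_j mu j * h s j * h t j ^+ q = 0)
    (S_card : (q ^ k * #|S| = q ^ (k + m + c) * q ^ c)%N)
    (sender : forall x : 'I_(k + m + c) -> F, (exists i, x i != 0) ->
       (#|[set i | x i != 0%R]| <= d - 1)%N ->
       exists s, psi (\sum_i lam i * g s i * x i ^+ q) != 1)
    (receiver : forall x : 'I_c -> F, (exists j, x j != 0) ->
       exists s, psi (\sum_j mu j * h s j * x j ^+ q) != 1) :
  exists Q : {vspace 'cV[Cx]_(#|word q (k + m + c)| * #|word q c|)}, eaqecc d Q.
Proof.
pose V s := nweyl lam (g s) *t nweyl mu (h s).
have g0 i : g 0 i = 0 by apply: (addrI (g 0 i)); rewrite -gD !addr0.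
have h0 j : h 0 j = 0 by apply: (addrI (h 0 j)); rewrite -hD !addr0.
have /fin_all_exists[beta VD] : forall st : S * S,
    exists b, V st.1 *m V st.2 = b *: V (st.1 + st.2).
  move=> [s t] /=; rewrite /V tensmx_mul.
  have [b ->] := nweylD lam_fix lam0 (fun i => gD s t i).
  have [b' ->] := nweylD mu_fix mu0 (fun i => hD s t i).
  by exists (b * b'); rewrite tensmx_scale.
have [||||||P [a [PP Padj trP a0 VP]]] :=
    @stabilizer_projector Cx S _ V (fun s t => beta (s, t)).
- by rewrite !card_ffun !card_ord muln_gt0 !expn_gt0 q_gt0.
- by rewrite /V !nweyl0 // tensmx11.
- by move=> s t; apply: (VD (s, t)).
- move=> s t; rewrite /V !tensmx_mul (nweylC lam_fix lam0 (g s)).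
  rewrite (nweylC mu_fix mu0 (h s)) tensmx_scale -psiD isotropic psi0.
  by rewrite scale1r.
- by move=> s; apply: tensmx_unitary; apply: nweyl_unitary.
- move=> s /g_neq0[i gi]; rewrite mxtrace_tens.
  by rewrite (nweyl_tr lam_fix lam0 gi) mul0r.
have S0 : #|S|%:R != 0 :> Cx.
  by rewrite pnatr_eq0 -lt0n; apply/card_gt0P; exists 0.
(* The count [S_card] gives [P] the trace [q ^ k] of a code with [k] data qudits. *)
apply: (@projector_eaqecc Cx q k m c q_gt0 d P) => // [|y y'|E [X [X_le]]].
- apply: (mulIf S0); rewrite trP -natrM S_card !card_ffun !card_ord.
  by rewrite natrM.
(* Every nontrivial receiver error is detected, so [S] may be the full set. The matrix unit is a
   product of one-qudit ones, of trace 1 or 0, which gives the required scalar. *)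
- rewrite delta_ntens.
  rewrite (@ntens_detect Cx q c _ P (fun T => P *m (1%:M *t T) *m P) F psi mu
    (fun j => W (mu j)) setT) //.
  + congr (_ *: _); rewrite big_split /= prodr_const card_ord exprVn -natrX.
    congr (_ * _); case: eqVneq => [->|yy'].
      rewrite big1 // => j _; rewrite /mxtrace (bigD1 (y' j)) //= mxE eqxx.
      by rewrite big1 ?addr0 // => l /negPf lj; rewrite mxE lj.
    have [j yj] : exists j, y j != y' j.
      apply/existsP; apply: contraNT yy' => /existsPn yy'.
      by apply/eqP/ffunP => j; have := yy' j; rewrite negbK => /eqP.
    rewrite (bigD1 j) //= /mxtrace big1 ?mul0r // => l _; rewrite mxE.
    by case: eqP => //= ->; rewrite (negPf yj).
  + by move=> j; apply: sysW.
  + move=> b A B; rewrite tensmx_linr mulmxDr mulmxDl.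
    by rewrite -scalemxAr -scalemxAl.
  + by rewrite tensmx11 mulmx1.
  + move=> x x0 _; have [s psi1] := receiver x x0; have [VsP PVs] := VP s.
    apply: (stabilizer_detect (a0 s) VsP PVs _ psi1).
    rewrite /V !tensmx_mul mul1mx mulmx1 -[X in X *t _]scale1r.
    by rewrite (nweylC mu_fix mu0 (h s) x) tensmx_scale mul1r.
  + by move=> j; rewrite inE.
move=> /acts_on_ntens[J [b [M [-> MX]]]].
exists (\sum_j b j * \prod_i (\tr (M j i) / q%:R)).
rewrite scaler_suml.
pose L T := P *m (T *t 1%:M : 'M[Cx]_(_ * #|word q c|)) *m P.
have L_lin t A B : L (t *: A + B) = t *: L A + L B.
  by rewrite /L tensmx_lin mulmxDr mulmxDl -scalemxAr -scalemxAl.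
have L0 : L 0 = 0.
  by apply: (addrI (L 0)); rewrite -[X in X + _]scale1r -L_lin scale1r !addr0.
rewrite -/(L _).
have -> : L (\sum_j b j *: ntens (M j)) = \sum_j b j *: L (ntens (M j)).
  by elim/big_rec2: _ => // j B B' _ <-; rewrite L_lin.
apply: eq_bigr => j _.
rewrite (@ntens_detect Cx q _ _ P L F psi lam (fun i => W (lam i)) X)
  ?scalerA //.
- by move=> i; apply: sysW.
- by rewrite /L tensmx11 mulmx1.
- move=> x x0 xX; have [||s psi1] := sender x => //.
    apply: leq_trans X_le; apply/subset_leq_card/subsetP => i; rewrite inE.
    by apply: contraNT => /xX ->.
  have [VsP PVs] := VP s; apply: (stabilizer_detect (a0 s) VsP PVs _ psi1).
  rewrite /V !tensmx_mul mul1mx mulmx1 -[X in _ *t X]scale1r.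
  by rewrite (nweylC lam_fix lam0 (g s) x) tensmx_scale mulr1.
exact: MX.
Qed.

End StabilizerCode.

(** * Hermitian duals, parity checks and information sets *)

Section HermitianDuals.
Variables (F : finFieldType) (q : nat).
Hypotheses (q_gt0 : (0 < q)%N).
Hypothesis F_expD : forall x y : F, (x + y) ^+ q = x ^+ q + y ^+ q.
Hypothesis F_expK : forall x : F, x ^+ q ^+ q = x.

Let F_exp_sum (I : finType) (f : I -> F) : (\sum_i f i) ^+ q = \sum_i f i ^+ q.
Proof. by apply: (big_morph _ F_expD); rewrite expr0n gtn_eqF. Qed.

Definition conjugate_tr m n (A : 'M[F]_(m, n)) : 'M_(n, m) :=
  \matrix_(i, j) A j i ^+ q.

Lemma conjugate_trK m n (A : 'M[F]_(m, n)) : conjugate_tr (conjugate_tr A) = A.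
Proof. by apply/matrixP => i j; rewrite !mxE F_expK. Qed.

Lemma conjugate_tr0 m n : conjugate_tr (0 : 'M[F]_(m, n)) = 0.
Proof. by apply/matrixP => i j; rewrite !mxE expr0n gtn_eqF. Qed.

Lemma conjugate_tr_mul m n p (A : 'M[F]_(m, n)) (B : 'M_(n, p)) :
  conjugate_tr (A *m B) = conjugate_tr B *m conjugate_tr A.
Proof.
apply/matrixP => i j; rewrite !mxE F_exp_sum; apply: eq_bigr => l _.
by rewrite !mxE exprMn mulrC.
Qed.

(** Conjugation turns a right inverse of [A] into a left inverse of its conjugate transpose. *)
Lemma rank_conjugate_tr m n (A : 'M[F]_(m, n)) : row_free A ->
  \rank (conjugate_tr A) = m.
Proof.
case/row_freeP => D AD; apply/eqP; rewrite eqn_leq rank_leq_col /=.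
rewrite -[X in (X <= _)%N](mxrank1 F m).
have <- : conjugate_tr D *m conjugate_tr A = 1%:M.
  rewrite -conjugate_tr_mul AD; apply/matrixP => i j; rewrite !mxE eq_sym.
  by case: eqP; rewrite ?expr1n // expr0n gtn_eqF.
exact: mxrankM_maxr.
Qed.

(** The rows of [H] form a basis of the Hermitian dual. Its inclusion in [C] gives the bound on [n]
    and self-orthogonality; the last clause says that the double dual lies in [C]. *)
Lemma hermitian_parity_check n (C : {vspace 'rV[F]_n}) :
  {subset hermitian_dual q C <= C} ->
  exists2 H : 'M[F]_(n - \dim C, n), row_free H &
  [/\ (n <= 2 * \dim C)%N,
      forall a b : 'rV_(n - \dim C), a *m H *m conjugate_tr (b *m H) = 0 &
      forall x, (forall a : 'rV_(n - \dim C), x *m conjugate_tr (a *m H) = 0) ->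
        x \in C].
Proof.
move=> C_dual; pose B : 'M[F]_(\dim C, n) := \matrix_i (vbasis C)`_i.
have BC v : (v \in C) = (v <= B)%MS.
  apply/idP/submxP => [vC|[a ->]].
    exists (\row_i coord (vbasis C) i v); rewrite mulmx_sum_row.
    rewrite {1}(coord_vbasis vC); apply: eq_bigr => i _.
    by rewrite mxE rowK.
  rewrite mulmx_sum_row rpred_sum // => i _; rewrite rpredZ // rowK.
  by rewrite vbasis_mem // mem_nth ?size_tuple.
have B_free : row_free B.
  apply: inj_row_free => a; rewrite mulmx_sum_row => aB.
  apply/rowP => i; rewrite mxE.
  have /freeP := basis_free (vbasisP C); apply.
  by rewrite -[RHS]aB; apply: eq_bigr => l _; rewrite rowK.
have B_rank : \rank B = \dim C by apply/eqP.
pose K := kermx (conjugate_tr B).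
have K_rank : \rank K = (n - \dim C)%N by rewrite mxrank_ker rank_conjugate_tr.
have [H H_free HK] :
    exists2 H : 'M[F]_(n - \dim C, n), row_free H & (H :=: K)%MS.
  move: (row_base K) (row_base_free K) (eq_row_base K).
  by rewrite K_rank => H; exists H.
have HB : H *m conjugate_tr B = 0 by apply/sub_kermxP; rewrite HK.
have dualP v : v *m conjugate_tr B = 0 -> v \in hermitian_dual q C.
  move=> vB; rewrite inE; apply/forall_inP => w; rewrite BC => /submxP[a wE].
  have : v *m conjugate_tr w = 0.
    by rewrite wE conjugate_tr_mul mulmxA vB mul0mx.
  move=> /matrixP/(_ 0 0); rewrite mxE [RHS]mxE => vw0.
  by rewrite -[X in _ == X]vw0; apply/eqP/eq_bigr => i _; rewrite mxE.
have HC (a : 'rV_(n - \dim C)) : (a *m H <= B)%MS.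
  by rewrite -BC; apply/C_dual/dualP; rewrite -mulmxA HB mulmx0.
exists H => //; split=> [|a b|x xH].
- have : (H <= B)%MS.
    by rewrite -[H]mul1mx; apply/row_subP => i; rewrite row_mul HC.
  move/mxrankS; rewrite (eqP H_free) B_rank; lia.
- have /submxP[z ->] := HC b.
  by rewrite conjugate_tr_mul mulmxA -(mulmxA a) HB mulmx0 mul0mx.
(* The row space of [B] is orthogonal to [H], and the orthogonal space of [H] has the same
   dimension, so they coincide. *)
have BH : (B <= kermx (conjugate_tr H))%MS.
  apply/sub_kermxP; rewrite -[LHS]conjugate_trK conjugate_tr_mul conjugate_trK.
  by rewrite HB conjugate_tr0.
rewrite BC; have := mxrank_leqif_sup BH => -[_].
rewrite mxrank_ker rank_conjugate_tr // B_rank.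
have dimCn : (\dim C <= n)%N by rewrite -B_rank rank_leq_col.
rewrite subKn // eqxx => /esym leHB; apply: submx_trans leHB.
apply/sub_kermxP/matrixP => i j; rewrite ord1 [RHS]mxE.
have /matrixP/(_ 0 0) := xH (delta_mx 0 j); rewrite -rowE [RHS]mxE => <-.
by rewrite !mxE; apply: eq_bigr => l _; rewrite !mxE.
Qed.

(** Select [r] independent columns of [H]; the resulting square matrix is invertible, so the symbols
    there can be prescribed. *)
Lemma information_set r n (H : 'M[F]_(r, n)) : row_free H ->
  exists2 f : 'I_r -> 'I_n, injective f &
    forall z : 'I_r -> F, exists a : 'rV[F]_r, forall l, (a *m H) 0 (f l) = z l.
Proof.
move=> H_free; have HT_full : row_full H^T by rewrite /row_full mxrank_tr.
exists (fullrankfun HT_full); first exact: fullrankfun_inj.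
move=> z; have := fullrowsub_full HT_full; set f := fullrankfun _.
rewrite row_full_unit => HT_unit.
exists ((\row_l z l) *m invmx (rowsub f H^T)^T) => l.
have -> (v : 'rV_r) : (v *m H) 0 (f l) = (v *m (rowsub f H^T)^T) 0 l.
  by rewrite !mxE; apply: eq_bigr => i _; rewrite !mxE.
by rewrite mulmxKV ?unitmx_tr // mxE.
Qed.

End HermitianDuals.

(** * The code built from the extended dual *)

Section EncodedCode.
Variables (Cx : numClosedFieldType) (F : finFieldType) (q : nat).

Definition ord_cons n (x : F) (v : 'I_n -> F) (i : 'I_n.+1) : F :=
  if unlift ord0 i is Some i' then v i' else x.

Lemma ord_cons0 n x (v : 'I_n -> F) : ord_cons x v ord0 = x.
Proof. by rewrite /ord_cons unlift_none. Qed.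

Lemma ord_consS n x (v : 'I_n -> F) i : ord_cons x v (lift ord0 i) = v i.
Proof. by rewrite /ord_cons liftK. Qed.

Variables (psi : F -> Cx) (W : F -> F -> 'M[Cx]_q).
Hypotheses (q_gt0 : (0 < q)%N) (F_card : #|F| = (q ^ 2)%N).
Hypothesis F_expD : forall x y : F, (x + y) ^+ q = x ^+ q + y ^+ q.
Hypothesis F_expK : forall x : F, x ^+ q ^+ q = x.
Hypothesis psiD : forall x y, psi (x + y) = psi x * psi y.
Hypothesis psi0 : psi 0 = 1.
Hypothesis psi_nontrivial : exists x, psi x != 1.
Hypothesis sysW : forall lam, lam ^+ q = lam -> lam != 0 ->
  weyl_system psi lam (W lam).

(* The stabilizer lives on the dual of [C] extended by one coordinate, the
   coordinate [ord0], which is shared with the receiver. The form is multiplied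
   by [l] at [c] coordinates of an information set of the dual, and the
   receiver's copies of these coordinates, weighted by [1 - l], restore
   self-orthogonality. *)
Lemma dual_containing_eaqecc (n d c : nat) (C : {vspace 'rV[F]_n}) (l : F) :
  l ^+ q = l -> l != 0 -> l != 1 ->
  (0 < d)%N ->
  (forall x, x \in C -> x != 0 -> (d <= #|[set i | x 0%R i != 0%R]|)%N) ->
  {subset hermitian_dual q C <= C} -> (c <= n - \dim C)%N ->
  eaqecc_exists Cx q n.+1 (2 * \dim C + c.+1 - n.+1) d c.+1.
Proof.
move=> l_fix l0 l1 d_gt0 C_dist C_dual c_le.
have dimCn : (\dim C <= n)%N.
  by have := dimvS (subvf C); rewrite dimvf /dim /= mul1n.
have [H H_free [dimC2 H_ortho H_dual]] :=
  hermitian_parity_check q_gt0 F_expD F_expK C_dual.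
have [f f_inj f_surj] := information_set H_free.
pose pos (j : 'I_c) := f (widen_ord c_le j).
have pos_inj : injective pos by move=> i j /f_inj/(congr1 val)/= /val_inj.
pose J := [set pos j | j : 'I_c].
(* By [dimC2] and [c_le] no subtraction truncates; [m] equals [2 * (n - \dim C - c)]. *)
pose k := (2 * \dim C + c.+1 - n.+1)%N; pose m := (n.+1 - k - c.+1)%N.
have nE : n.+1 = (k + m + c.+1)%N by rewrite /m /k; lia.
exists m; split=> //; rewrite -/k.
pose lam : 'I_n.+1 -> F := ord_cons 1 (fun i => if i \in J then l else 1).
pose mu : 'I_c.+1 -> F := ord_cons (-1) (fun=> 1 - l).
pose S : finZmodType := 'rV[F]_(1 + (n - \dim C)).
pose w (s : S) : F := lsubmx s 0 0; pose a (s : S) := rsubmx s *m H.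
pose g (s : S) : 'I_n.+1 -> F := ord_cons (w s) (fun i => a s 0 i).
pose h (s : S) : 'I_c.+1 -> F := ord_cons (w s) (fun j => a s 0 (pos j)).
(* Rescaling on [J] changes the form by exactly what the receiver's weights [1 - l] add back. *)
have sumJ (X : 'I_n -> F) :
    \sum_i (if i \in J then l else 1) * X i =
    \sum_i X i - (1 - l) * \sum_j X (pos j).
  have XJ : \sum_(i in J) X i = \sum_j X (pos j).
    rewrite big_imset => [|i j _ _ /pos_inj//].
    by apply: eq_bigl => j; rewrite inE.
  transitivity (l * (\sum_(i in J) X i) + \sum_(i | i \notin J) X i).
    rewrite (bigID (mem J)) /= mulr_sumr; congr (_ + _); apply: eq_bigr => i iJ.
      by rewrite iJ.
    by rewrite (negPf iJ) mul1r.
  rewrite [\sum_i X i](bigID (mem J)) /= XJ; ring.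
have Sw x : exists s, w s = x /\ a s = 0.
  exists (row_mx x%:M 0); rewrite /w /a row_mxKl row_mxKr mul0mx.
  by rewrite !mxE eqxx.
have Sa v : exists s, w s = 0 /\ a s = v *m H.
  by exists (row_mx 0 v); rewrite /w /a row_mxKl row_mxKr mxE.
have F_exp0 : 0 ^+ q = 0 :> F by rewrite expr0n gtn_eqF.
have N1_fix : (- 1) ^+ q = - 1 :> F.
  apply/eqP; rewrite -addr_eq0 addrC -[X in X + _](expr1n F q) -F_expD.
  by rewrite subrr F_exp0.
have lam_fix i : lam i ^+ q = lam i.
  rewrite /lam /ord_cons; case: unlift => [i'|]; last by rewrite expr1n.
  by case: ifP => _; rewrite ?expr1n.
have lam0 i : lam i != 0.
  rewrite /lam /ord_cons; case: unlift => [i'|]; last exact: oner_neq0.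
  by case: ifP => _; rewrite ?oner_neq0.
have l1_fix : (1 - l) ^+ q = 1 - l.
  by rewrite F_expD -mulN1r exprMn N1_fix l_fix expr1n.
have mu_fix j : mu j ^+ q = mu j by rewrite /mu /ord_cons; case: unlift.
have mu0 j : mu j != 0.
  rewrite /mu /ord_cons; case: unlift => [j'|].
    by rewrite subr_eq0 eq_sym.
  by rewrite oppr_eq0 oner_neq0.
have gD s t i : g (s + t) i = g s i + g t i.
  rewrite /g /ord_cons /a /w !linearD /= mulmxDl.
  by case: unlift => [i'|]; rewrite !mxE.
have hD s t j : h (s + t) j = h s j + h t j.
  rewrite /h /ord_cons /a /w !linearD /= mulmxDl.
  by case: unlift => [j'|]; rewrite !mxE.
have g_neq0 s : s != 0 -> exists i, g s i != 0.
  move=> s0; apply/existsP; apply: contraNT s0 => /existsPn g0.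
  have gs i : g s i = 0 by have := g0 i; rewrite negbK => /eqP.
  have ws : w s = 0 by rewrite -(gs ord0) /g ord_cons0.
  have as0 : rsubmx s *m H = 0.
    by apply/rowP => i; rewrite [RHS]mxE -(gs (lift ord0 i)) /g ord_consS.
  have rs : rsubmx s = 0 by apply: (row_free_inj H_free); rewrite /= mul0mx.
  have ls : lsubmx s = 0.
    by apply/matrixP => i j; rewrite !ord1 [RHS]mxE -/(w s).
  by rewrite -[s]hsubmxK rs ls row_mx0.
have isotropic s t : \sum_i lam i * g s i * g t i ^+ q +
                     \sum_j mu j * h s j * h t j ^+ q = 0.
  rewrite !big_ord_recl /lam /mu /g /h !ord_cons0.
  under eq_bigr => i _ do rewrite !ord_consS -mulrA.
  under [X in _ + (_ + X)]eq_bigr => i _ do rewrite !ord_consS -mulrA.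
  rewrite sumJ -mulr_sumr; have -> : \sum_i a s 0 i * a t 0 i ^+ q = 0.
    have /matrixP/(_ 0 0) := H_ortho (rsubmx s) (rsubmx t).
    rewrite mxE [RHS]mxE => ortho; rewrite -[RHS]ortho.
    by apply: eq_bigr => i _; rewrite [X in _ = _ * X]mxE.
  ring.
have S_card : (q ^ k * #|S| = q ^ n.+1 * q ^ c.+1)%N.
  rewrite card_mx F_card -expnM -!expnD; congr (_ ^ _)%N; rewrite /k; lia.
have scale_sum (I : finType) (lm x y : I -> F) b :
    \sum_i lm i * (b * x i) * y i = b * \sum_i lm i * x i * y i.
  by rewrite mulr_sumr; apply: eq_bigr => i _; rewrite mulrCA !mulrA.
have [z psi_z] := psi_nontrivial.
have receiver (x : 'I_c.+1 -> F) : (exists j, x j != 0) ->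
    exists s, psi (\sum_j mu j * h s j * x j ^+ q) != 1.
  move=> [j]; case: (unliftP ord0 j) => [{}j|] -> xj.
    (* The shared coordinates belong to an information set: a dual word can have symbol [z / b] at
       the one for [j] and 0 at the others, which makes the sum equal to [z]. *)
    pose b := (1 - l) * x (lift ord0 j) ^+ q.
    have b0 : b != 0 by rewrite mulf_neq0 ?expf_neq0 // subr_eq0 eq_sym.
    have [v vE] := f_surj (fun i => if i == widen_ord c_le j then z / b else 0).
    have [s [ws as_]] := Sa v; exists s.
    rewrite big_ord_recl /mu /h !ord_cons0 ws mulr0 mul0r add0r.
    under eq_bigr => i _ do rewrite !ord_consS as_ /pos vE.
    rewrite (bigD1 j) //= eqxx big1 ?addr0 => [|i ij].
      by rewrite mulrAC -/b mulrC divfK.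
    by rewrite -val_eqE /= val_eqE (negPf ij) mulr0 mul0r.
  (* The minus sign compensates the weight -1 of the free coordinate. *)
  have [s [ws as_]] := Sw (- (z / x ord0 ^+ q)); exists s.
  rewrite big_ord_recl /mu /h !ord_cons0 ws mulrNN mul1r divfK ?expf_neq0 //.
  by rewrite big1 ?addr0 // => i _; rewrite !ord_consS as_ mxE mulr0 mul0r.
have sender (x : 'I_n.+1 -> F) : (exists i, x i != 0) ->
    (#|[set i | x i != 0%R]| <= d - 1)%N ->
    exists s, psi (\sum_i lam i * g s i * x i ^+ q) != 1.
  (* An error touching the extra coordinate is detected by a stabilizer element supported there,
     whatever its other entries are. *)
  move=> [i0 xi0] x_le; have [x0|x0] := eqVneq (x ord0) 0; last first.
    have [s [ws as_]] := Sw (z / x ord0 ^+ q); exists s.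
    rewrite big_ord_recl /lam /g !ord_cons0 ws mul1r divfK ?expf_neq0 //.
    by rewrite big1 ?addr0 // => i _; rewrite !ord_consS as_ mxE mulr0 mul0r.
  (* Since [lam] is nonzero and fixed by conjugation, it can be moved onto the error without
     changing the support. Thus [y] has weight less than [d], lies outside [C], and fails to be
     orthogonal to some dual word. *)
  pose y : 'rV[F]_n := \row_i (lam (lift ord0 i) * x (lift ord0 i)).
  have y0 : y != 0.
    move: xi0; case: (unliftP ord0 i0) => [i ->|->]; last by rewrite x0 eqxx.
    apply: contraNneq => /rowP/(_ i); rewrite !mxE => /eqP.
    by rewrite mulf_eq0 (negPf (lam0 _)).
  have yC : y \notin C.
    apply/negP => yC; have := C_dist y yC y0; apply/negP; rewrite -ltnNge.
    apply: (@leq_ltn_trans (d - 1)); last by rewrite subn1 prednK.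
    apply: leq_trans x_le; rewrite -(card_imset _ (@lift_inj _ ord0)).
    apply/subset_leq_card/subsetP => _ /imsetP[i yi ->]; move: yi.
    by rewrite !inE mxE mulf_eq0 negb_or => /andP[].
  have [v yv] : exists v : 'rV_(n - \dim C), y *m conjugate_tr q (v *m H) != 0.
    apply/existsP; apply: contraNT yC => /existsPn yv; apply: H_dual => v.
    by have := yv v; rewrite negbK => /eqP.
  (* This is the conjugate of the nonzero product in [yv]; rescaling [v] by [z / b] then brings the
     argument of [psi] to [z]. *)
  pose b := \sum_i lam (lift ord0 i) * (v *m H) 0 i * x (lift ord0 i) ^+ q.
  have b0 : b != 0.
    apply: contraNneq yv => b0; have bE : v *m H *m conjugate_tr q y = 0.
      apply/matrixP => i j; rewrite !ord1 [RHS]mxE -b0 mxE.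
      apply: eq_bigr => i' _; rewrite !mxE exprMn lam_fix; ring.
    rewrite -[_ *m _](conjugate_trK F_expK) conjugate_tr_mul //.
    by rewrite (conjugate_trK F_expK) bE conjugate_tr0.
  have [s [ws as_]] := Sa ((z / b) *: v); exists s.
  rewrite big_ord_recl /g !ord_cons0 ws mulr0 mul0r add0r.
  under eq_bigr => i _ do rewrite !ord_consS as_ -scalemxAl mxE.
  by rewrite scale_sum -/b divfK.
clearbody lam g k m; move: lam g lam_fix lam0 gD g_neq0 isotropic S_card sender.
rewrite nE => lam g lam_fix lam0 gD g_neq0 isotropic S_card sender.
exact: (stabilizer_eaqecc q_gt0 F_card psiD psi0 sysW lam_fix lam0 mu_fix mu0
  gD hD g_neq0 isotropic S_card sender receiver).
Qed.

End EncodedCode.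

(* 2 * k + c - n.+1 is not truncated: C_dual gives n <= 2 * k. *)
Theorem proposition4p7 (R : realType) (p r q : nat) (F : finFieldType)
    (n k d c : nat) (C : {vspace 'rV[F]_n})
    (p_prime : prime p) (r_gt0 : (0 < r)%N) (q_def : q = (p ^ r)%N)
    (q_gt2 : (2 < q)%N) (F_card : #|F| = (q ^ 2)%N)
    (C_code : linear_code C k d)
    (C_dual : {subset hermitian_dual q C <= C})
    (c_gt0 : (0 < c)%N) (c_le : (c <= n - k + 1)%N) :
  exists d' : nat, (d' = d \/ d' = d.+1) /\
    eaqecc_exists R[i] q n.+1 (2 * k + c - n.+1) d' c.
Proof.
exists d; split; first by left.
case: C_code => dimC [[u [v [_ _ uv duv]]] C_dist]; subst k.
have d_gt0 : (0 < d)%N.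
  rewrite -duv card_gt0; apply: contraNneq uv => uv.
  apply/eqP/rowP => i; have /setP/(_ i) := uv; rewrite !inE => /negbT.
  by rewrite negbK => /eqP.
have q_gt0 : (0 < q)%N by rewrite (leq_trans _ q_gt2).
have F_expD := subfield_expD p_prime q_def F_card.
have F_expK := subfield_expK F_card.
have [psi [W [psiD psi0 psi_nontrivial sysW]]] :=
  weyl_systems_exist R[i] p_prime r_gt0 q_def F_card.
have [e [e_inj e_fix _]] := subfield_enum p_prime r_gt0 q_def F_card.
(* As [q > 2], the [q] elements of the subfield do not all lie in [[:: 0; 1]]; one of the others
   serves as the scaling factor [l]. *)
have [j ej] : exists j, e j \notin [:: 0; 1].
  apply/existsP; apply: contraTT q_gt2 => /existsPn e01; rewrite -leqNgt.
  rewrite -[q]card_ord -(size_codom e); apply: (@uniq_leq_size _ _ [:: 0; 1]).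
    by rewrite (map_inj_uniq e_inj) enum_uniq.
  by move=> _ /codomP[j ->]; have := e01 j; rewrite negbK.
move: ej; rewrite !inE negb_or => /andP[ej0 ej1].
rewrite -[c]prednK //.
apply: (dual_containing_eaqecc q_gt0 F_card F_expD F_expK psiD psi0
  psi_nontrivial sysW (e_fix j) ej0 ej1 d_gt0) => // [x xC x0|].
  have := C_dist x 0 xC (mem0v C) x0; rewrite /hamming_dist.
  by under eq_finset => i do rewrite [X in _ != X]mxE.
by rewrite -ltnS prednK // -addn1.
Qed.
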